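(* Let $f:\Omega_D\to\mathbb{H}$ be an injective slice regular function. Then $N_f=\emptyset$; that is, the real differential of $f$ is invertible at every point of $\Omega_D$.
   Context: $\mathbb{H}$ is the real algebra of quaternions and $\mathbb{S}=\{q\in\mathbb{H} : q^2=-1\}$ its sphere of imaginary units; every $x\in\mathbb{H}$ can be written $x=\alpha+I\beta$ with $\alpha,\beta\in\mathbb{R}$, $I\in\mathbb{S}$. $D\subset\mathbb{C}$ is an open set symmetric with respect to the real axis, and $\Omega_D:=\{\alpha+J\beta\in\mathbb{H} : \alpha+i\beta\in D,\ J\in\mathbb{S}\}$ is its circularization ($\Omega_D$ may or may not meet $\mathbb{R}$). Let $\mathbb{H}_{\mathbb{C}}=\mathbb{H}\otimes_{\mathbb{R}}\mathbb{C}=\{p+\sqrt{-1}q : p,q\in\mathbb{H}\}$. A stem function on $D$ is a map $F=F_1+\sqrt{-1}F_2:D\to\mathbb{H}_{\mathbb{C}}$ ($F_1,F_2$ being $\mathbb{H}$-valued) with $F_1(\bar z)=F_1(z)$ and $F_2(\bar z)=-F_2(z)$ for all $z\in D$. It induces the slice function $f=\mathcal{I}(F):\Omega_D\to\mathbb{H}$, $f(\alpha+J\beta):=F_1(\alpha+i\beta)+JF_2(\alpha+i\beta)$. The slice function $f=\mathcal{I}(F)$ is slice regular if $F$ is of class $\mathcal{C}^1$ and $\partial F/\partial\bar z=\frac12\left(\frac{\partial F}{\partial\alpha}+\sqrt{-1}\frac{\partial F}{\partial\beta}\right)\equiv 0$, i.e. $\frac{\partial F_1}{\partial\alpha}=\frac{\partial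 F_2}{\partial\beta}$ and $\frac{\partial F_1}{\partial\beta}=-\frac{\partial F_2}{\partial\alpha}$ on $D$. The singular set of $f$ is $N_f:=\{x\in\Omega_D : \text{the real differential } df \text{ is not invertible at } x\}$, where $f$ is regarded as a map between open subsets of $\mathbb{R}^4\cong\mathbb{H}$. *)

(* Defs.v *)
From HB Require Import structures.
From mathcomp Require Import all_boot all_order all_algebra.
From mathcomp Require Import all_classical all_reals all_analysis.
From mathcomp Require Import ring.

Set Implicit Arguments.
Unset Strict Implicit.
Unset Printing Implicit Defensive.
Import Order.TTheory GRing.Theory Num.Theory.
Import numFieldNormedType.Exports.
Local Open Scope classical_set_scope.
Local Open Scope ring_scope.

(* The alias carries the normed R-module structure of R^4 (any norm will do:
   only the topology and differentials are used) together with Hamilton's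
   product, in the coordinates of the basis 1, i, j, k. *)
Definition quat (R : realType) := 'rV[R]_4.

HB.instance Definition _ (R : realType) :=
  NormedModule.copy (quat R) 'rV[R]_4.

Section Quaternions.
Variable R : realType.
Implicit Types p q r : quat R.

Definition mkquat (a b c d : R) : quat R := \row_(k < 4) [:: a; b; c; d]`_k.

Definition qcoord q (k : nat) : R := (q : 'rV[R]_4) ord0 (inord k).

Definition oneq : quat R := mkquat 1 0 0 0.

Definition mulq p q : quat R :=
  let p0 := qcoord p 0 in let p1 := qcoord p 1 in
  let p2 := qcoord p 2 in let p3 := qcoord p 3 in
  let q0 := qcoord q 0 in let q1 := qcoord q 1 in
  let q2 := qcoord q 2 in let q3 := qcoord q 3 in
  mkquat (p0 * q0 - p1 * q1 - p2 * q2 - p3 * q3)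
         (p0 * q1 + p1 * q0 + p2 * q3 - p3 * q2)
         (p0 * q2 - p1 * q3 + p2 * q0 + p3 * q1)
         (p0 * q3 + p1 * q2 - p2 * q1 + p3 * q0).

Lemma qcoord_mk a b c d k : (k < 4)%N ->
  qcoord (mkquat a b c d) k = [:: a; b; c; d]`_k.
Proof. by move=> k4; rewrite /qcoord mxE inordK. Qed.

Lemma qcoordD p q k : qcoord (p + q) k = qcoord p k + qcoord q k.
Proof. by rewrite /qcoord mxE. Qed.

Lemma qcoordZ (a : R) q k : qcoord (a *: q) k = a * qcoord q k.
Proof. by rewrite /qcoord mxE. Qed.

Lemma quatP p q :
  (forall k, (k < 4)%N -> qcoord p k = qcoord q k) -> p = q.
Proof.
move=> pq; apply/rowP => k; have := pq k (ltn_ord k).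
by rewrite /qcoord inord_val.
Qed.

Let qE := (qcoordD, qcoordZ, qcoord_mk).

Fact mulqA : associative mulq.
Proof.
move=> p q r; apply: quatP => -[|[|[|[|//]]]] _; rewrite /mulq !qE //=; ring.
Qed.

Fact mul1q : left_id oneq mulq.
Proof.
move=> p; apply: quatP => -[|[|[|[|//]]]] _; rewrite /mulq /oneq !qE //=; ring.
Qed.

Fact mulq1 : right_id oneq mulq.
Proof.
move=> p; apply: quatP => -[|[|[|[|//]]]] _; rewrite /mulq /oneq !qE //=; ring.
Qed.

Fact mulqDl : left_distributive mulq +%R.
Proof.
move=> p q r; apply: quatP => -[|[|[|[|//]]]] _; rewrite /mulq !qE //=; ring.
Qed.

Fact mulqDr : right_distributive mulq +%R.
Proof.
move=> p q r; apply: quatP => -[|[|[|[|//]]]] _; rewrite /mulq !qE //=; ring.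
Qed.

Fact oneq_neq0 : oneq != 0.
Proof.
apply/eqP => /(congr1 (fun q => qcoord q 0)) /eqP.
by rewrite /oneq qcoord_mk //= /qcoord mxE oner_eq0.
Qed.

HB.instance Definition _ := GRing.Zmodule_isNzRing.Build (quat R)
  mulqA mul1q mulq1 mulqDl mulqDr oneq_neq0.

Fact scaleqAl (a : R) p q : a *: (p * q) = (a *: p) * q.
Proof.
apply: quatP => -[|[|[|[|//]]]] _; rewrite /GRing.mul /= /mulq !qE //=; ring.
Qed.

HB.instance Definition _ := GRing.Lmodule_isLalgebra.Build R (quat R) scaleqAl.

Fact scaleqAr (a : R) p q : a *: (p * q) = p * (a *: q).
Proof.
apply: quatP => -[|[|[|[|//]]]] _; rewrite /GRing.mul /= /mulq !qE //=; ring.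
Qed.

HB.instance Definition _ := GRing.Lalgebra_isAlgebra.Build R (quat R) scaleqAr.

Lemma quat_relations (i := mkquat 0 1 0 0) (j := mkquat 0 0 1 0)
    (k := mkquat 0 0 0 1) :
  [/\ i ^+ 2 = -1, j ^+ 2 = -1, k ^+ 2 = -1 & i * j * k = -1].
Proof.
have N1 : (-1 : quat R) = mkquat (-1) 0 0 0.
  by apply: quatP => -[|[|[|[|//]]]] _; rewrite /qcoord !mxE !inordK //= oppr0.
rewrite N1; split; apply: quatP => -[|[|[|[|//]]]] _;
  rewrite ?expr2 /GRing.mul /= /mulq !qE //=; ring.
Qed.

End Quaternions.

Section SliceFunctions.
Variable R : realType.

(* The complex number alpha + i beta is the pair (alpha, beta) : R * R, and the
   element p + sqrt(-1) q of the complexification of the quaternions is the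
   pair (p, q).  Functions on a set are total; all conditions below only
   involve their values on (or near points of) that set, which is open. *)
Local Notation C := (R * R)%type.
Local Notation H := (quat R).
Local Notation HC := (quat R * quat R)%type.

Definition conjC (z : C) : C := (z.1, - z.2).

Definition symmetric_wrt_real_axis (D : set C) : Prop :=
  forall z, D z -> D (conjC z).

Definition imaginary_units : set H := [set q | q ^+ 2 = -1].

(* The point alpha + J beta of the quaternions, where z = alpha + i beta. *)
Definition slice_point (z : C) (J : H) : H := z.1%:A + z.2 *: J.

Definition circularization (D : set C) : set H :=
  [set x | exists z J, [/\ D z, imaginary_units J & x = slice_point z J]].

(* Left multiplication by sqrt(-1) in HC. *)
Definition mul_sqrtN1 (w : HC) : HC := (- w.2, w.1).

Definition stem_function (D : set C) (F : C -> HC) : Prop :=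
  forall z, D z -> (F (conjC z)).1 = (F z).1 /\ (F (conjC z)).2 = - (F z).2.

(* f = I(F) on the circularization of D. *)
Definition induced_by (D : set C) (F : C -> HC) (f : H -> H) : Prop :=
  forall z J, D z -> imaginary_units J ->
    f (slice_point z J) = (F z).1 + J * (F z).2.

Definition d_alpha (F : C -> HC) : C -> HC := 'D_((1, 0) : C) F.
Definition d_beta (F : C -> HC) : C -> HC := 'D_((0, 1) : C) F.

Definition of_class_C1 (D : set C) (F : C -> HC) : Prop :=
  forall z, D z ->
    [/\ derivable F z ((1, 0) : C), derivable F z ((0, 1) : C),
        {for z, continuous (d_alpha F)} & {for z, continuous (d_beta F)}].

Definition dbar (F : C -> HC) (z : C) : HC :=
  2^-1 *: (d_alpha F z + mul_sqrtN1 (d_beta F z)).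

Definition slice_regular (D : set C) (f : H -> H) : Prop :=
  exists F : C -> HC, [/\ stem_function D F, induced_by D F f,
    of_class_C1 D F & forall z, D z -> dbar F z = 0].

(* The differential is the linear map 'd f x, which is only meaningful when f
   is differentiable at x; differentiability is part of being invertible. *)
Definition differential_invertible (f : H -> H) (x : H) : Prop :=
  differentiable f x /\ bijective ('d f x).

Definition singular_set (D : set C) (f : H -> H) : set H :=
  [set x | circularization D x /\ ~ differential_invertible f x].

End SliceFunctions.

(* Main.v *)
From HB Require Import structures.
Require Import Defs.
From mathcomp Require Import all_boot all_order all_algebra.
From mathcomp Require Import all_classical all_reals all_analysis.
From mathcomp Require Import ring lra.
Import Order.TTheory GRing.Theory Num.Theory.
Import numFieldNormedType.Exports.
Set Implicit Arguments.
Unset Strict Implicit.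
Unset Printing Implicit Defensive.
Local Open Scope classical_set_scope.
Local Open Scope ring_scope.

(* For c in H, the form N_c = |F_1 - c|^2 - |F_2|^2 + 2i <F_1 - c, F_2> is
   holomorphic on D, and N_c(z) = 0 exactly when f takes the value c on the
   sphere of z.  By injectivity, for c = f(x) with x = alpha + J beta, N_c has
   no zero near z_x = alpha + i beta other than z_x itself.  If beta <> 0,
   df_x is singular only if F_2(z_x) = 0 (excluded by injectivity) or
   N_c'(z_x) = 0.

   Whenever N_c'(z_x) <> 0, the function (z - z_x) / N_c(z) is holomorphic off
   z_x and tends to 1 / N_c'(z_x) there, so the mean value property on circles
   centered at z_x bounds |N_c'(z_x)| from below by min |N_c| / r, which is
   locally uniform in x.  Hence if N_c'(z_x) vanishes at one x it vanishes for
   all nearby x; this forces F' = 0 near z_x, so F is locally constant,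
   contradicting injectivity.  At a real point df is right multiplication by
   F_1'(z_x), and the same argument applies to (z - z_x)^2 / N_c(z), along real
   x, whose limit at z_x is 1 / |F_1'(z_x)|^2. *)

(** * Mean values of holomorphic functions at the center of a punctured disc *)

Section MeanValue.
Variable R : realType.

(** The lower bound on |N_c'| plays the role of Hurwitz's theorem. A double zero of N_c at z_x would
    in general split when c moves; for nearby values c of f a split zero would give c a second
    preimage, so the zero has to stay double. Link with df: put g = F_1' + J F_2' and s = F_2(z_x).
    Then df sends the plane R + RJ to (R + RJ) g by right multiplication, and a vector W orthogonal
    to that plane to W s / beta, which is orthogonal to (R + RJ) s. So df can be singular with s <>
    0 only if g is orthogonal to both s and J s, and these two scalar products are, up to sign, the
    components of N_c'(z_x) / 2. Why F' = 0 follows: z and J vary independently near x. For fixed z,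
    N_c'(z) is affine in J, and an affine function that vanishes on an open piece of the sphere of
    units has vanishing coefficients. N_c also vanishes at the conjugate of z_x. The discs must
    avoid that point, hence the work in the upper half-plane; at a real z_x the two zeros collide,
    which explains the factor (z - z_x)^2. *)

Lemma equicontinuous_rectangle (A : R * R -> R) (a b c d e : R) : 0 < e ->
  (forall r t, a <= r <= b -> c <= t <= d -> {for (r, t), continuous A}) ->
  exists2 eta, 0 < eta & forall r t t', a <= r <= b -> c <= t <= d ->
    `|t - t'| < eta -> `|A (r, t) - A (r, t')| <= e.
Proof.
move=> e0 cA.
have cK := compact_setX (@segment_compact R a b) (@segment_compact R c d).
(* The covering parameter is eta tending to 0 from the right. Continuity of [A] holds in the whole
   plane at points of the rectangle, so t' may leave the segment. *)
have /= := (compact_near_coveringP _).1 cK R (0 : R)^'+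
  (fun eta p => forall t', `|p.2 - t'| < eta -> `|A p - A (p.1, t')| <= e) _.
case=> [|eta /= eta0 H].
  move=> [r t] [/= +]; rewrite !in_itv /= => ab cd.
  have e20 : 0 < e / 2 by rewrite divr_gt0.
  have /cvgrPdist_lt/(_ _ e20)/nbhs_normP[h /= h0 hA] := cA r t ab cd.
  have h20 : 0 < h / 2 by rewrite divr_gt0.
  have close p : ball (r, t) h p -> `|A (r, t) - A p| < e / 2.
    by move=> hp; apply: hA; rewrite -ball_normE in hp.
  exists (ball (r, t) (h / 2), [set eta | eta < h / 2]) => /=.
    split; first exact: nbhsx_ballx.
    by exists (h / 2) => // x /= + _; rewrite sub0r normrN; apply: le_lt_trans;
      rewrite ler_norm.
  move=> [[r1 t1] eta] /= [[rr tt] he] t' tt'.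
  have := close (r1, t1) _; have := close (r1, t') _.
  rewrite /ball /= /prod_ball /ball /= in rr tt *.
  have -> : `|t - t'| < h.
    rewrite -(subrK t1 t) -addrA (le_lt_trans (ler_normD _ _)) // (splitr h).
    by rewrite ltrD // (lt_trans tt').
  have -> : `|r - r1| < h by rewrite (lt_trans rr) //; lra.
  have -> : `|t - t1| < h by rewrite (lt_trans tt) //; lra.
  move=> /(_ (conj isT isT)) k1 /(_ (conj isT isT)) k2.
  rewrite -(subrK (A (r, t)) (A (r1, t1))) -addrA.
  rewrite (le_trans (ler_normD _ _)) // (splitr e) lerD // ltW //.
  by rewrite distrC.
exists (eta / 2); first by rewrite divr_gt0.
move=> r t t' rab tcd tt'.
apply: (H (eta / 2) _ _ (r, t)) => //=.
- by rewrite sub0r normrN ger0_norm; lra.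
- by rewrite divr_gt0.
Qed.

(* Instead of integrals, sums over n equidistant points of the circles are
   compared: the r-derivative of the sum of U is the sum of A, and the mean value
   theorem for V together with its periodicity makes the latter o(n). *)
Lemma polar_mean_value (U V A : R * R -> R) (r0 T u1 M : R) :
  0 < r0 -> 0 < T ->
  (forall r t, 0 < r <= r0 -> 0 <= t <= T ->
    [/\ is_derive r 1 (fun r => U (r, t)) (A (r, t)),
        is_derive t 1 (fun t => V (r, t)) (r * A (r, t)) &
        {for (r, t), continuous A}]) ->
  (forall r, V (r, 0) = V (r, T)) ->
  (forall e, 0 < e -> exists2 d, 0 < d & forall r t, 0 < r < d ->
     `|U (r, t) - u1| <= e) ->
  (forall t, 0 <= t <= T -> `|U (r0, t)| <= M) ->
  `|u1| <= M.
Proof.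
move=> r00 T0 H HV Hu HM.
(* The slack (1 + r0) * e collects e from the limit at the center and r0 * e from the variation of
   the sum between an inner radius and r0. *)
suff main e : 0 < e -> `|u1| <= M + (1 + r0) * e.
  apply/ler_addgt0Pr => e e0.
  have r10 : 0 < 1 + r0 by rewrite addr_gt0.
  apply: le_trans (main (e / (1 + r0)) _) _; first by rewrite divr_gt0.
  by rewrite mulrC divfK // gt_eqF.
move=> e0; have [d d0 Hd] := Hu _ e0.
pose rho := Num.min d r0 / 2.
have m0 : 0 < Num.min d r0 by rewrite lt_min d0.
have rho0 : 0 < rho by rewrite divr_gt0.
have rhom : rho < Num.min d r0 by rewrite /rho; lra.
have rhod : rho < d by rewrite (lt_le_trans rhom) // ge_min lexx.
have rhor : rho < r0 by rewrite (lt_le_trans rhom) // ge_min lexx orbT.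
have [eta eta0 Heta] := @equicontinuous_rectangle A rho r0 0 T e e0
  (fun r t hr ht => let: And3 _ _ c := H r t
     (introT andP (conj (lt_le_trans rho0 (proj1 (andP hr))) (proj2 (andP hr)))) ht in c).
(* Enough points for the mesh T / n to be smaller than the modulus of continuity eta; the successor
   also makes n positive. *)
pose n := (Num.trunc (T / eta)).+1.
have nR : 0 < n%:R :> R by rewrite ltr0n.
have Tn : T / n%:R < eta.
  rewrite ltr_pdivrMr // mulrC -ltr_pdivrMr // /n.
  by rewrite truncnS_gt.
pose th j : R := j%:R * (T / n%:R).
have th_ge0 j : 0 <= th j by rewrite mulr_ge0 // divr_ge0 // ltW.
have thS j : th j.+1 = th j + T / n%:R by rewrite /th -natr1 mulrDl mul1r.
have thn : th n = T by rewrite /th mulrC divfK // gt_eqF.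
have th_le j : (j <= n)%N -> th j <= T.
  by move=> jn; rewrite -[leRHS]thn /th ler_wpM2r ?ler_nat // divr_ge0 // ltW.
have thin (j : 'I_n) : 0 <= th j <= T by rewrite th_ge0 th_le // ltnW.
have sumA r : rho <= r <= r0 -> `|\sum_(j < n) A (r, th j)| <= n%:R * e.
  move=> /andP[r1 r2]; have rpos : 0 < r by exact: lt_le_trans r1.
  have rr : 0 < r <= r0 by rewrite rpos.
  (* On each arc the increment of [V] is r * T / n times a value of [A] at an intermediate angle,
     and that value is within e of the value at the node. *)
  have step (j : 'I_n) : exists x, `|A (r, th j) - x| <= e /\
      V (r, th j.+1) - V (r, th j) = r * x * (T / n%:R).
    have jle : th j < th j.+1 by rewrite thS ltrDl divr_gt0.
    have jin t : t \in `[th j, th j.+1]%R -> 0 <= t <= T.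
      rewrite in_itv /= => /andP[t1 t2]; rewrite (le_trans _ t1) //=.
      by rewrite (le_trans t2) // th_le.
    have [x||x xin /= ->] := @MVT_segment R (fun t => V (r, t))
        (fun t => r * A (r, t)) _ _ (ltW jle).
    - by move=> xin; have [] := H r x rr (jin _ (subset_itv_oo_cc xin)).
    - apply: derivable_within_continuous => y xin.
      by have [_ []] := H r y rr (jin _ xin).
    exists (A (r, x)); split; last by rewrite thS addrAC subrr add0r.
    apply: Heta; rewrite ?r1 ?r2 ?th_ge0 ?th_le //; last first.
      apply: le_lt_trans Tn; move: xin; rewrite in_itv /= thS => /andP[x1 x2].
      by rewrite distrC ger0_norm ?subr_ge0 // lerBlDl.
    exact: ltnW (ltn_ord j).
  have [X HX] := choice step.
  (* The increments of [V] telescope over a full period to zero, so the intermediate values of [A]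
     sum to zero and the node values to at most n * e. *)
  have sumX : \sum_(j < n) X j = 0.
    have : \sum_(j < n) (V (r, th j.+1) - V (r, th j)) = 0.
      have -> : \sum_(j < n) (V (r, th j.+1) - V (r, th j)) = V (r, th n) - V (r, th 0).
        by rewrite -(telescope_sumr (fun j => V (r, th j))) // big_mkord.
      by rewrite thn /th mul0r -HV subrr.
    under eq_bigr => j _ do rewrite (HX j).2.
    rewrite -mulr_suml -mulr_sumr => /eqP; rewrite !mulf_eq0 invr_eq0.
    by rewrite (gt_eqF rpos) (gt_eqF T0) (gt_eqF nR) !orbF => /eqP.
  rewrite -[X in `|X|]subr0 -[X in _ - X]sumX -sumrB.
  apply: le_trans (ler_norm_sum _ _ _) _.
  apply: le_trans (ler_sum _ (fun j _ => (HX j).1)) _.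
  by rewrite sumr_const card_ord mulr_natl.
pose m r := \sum_(j < n) U (r, th j).
have dm r : rho <= r <= r0 -> is_derive r 1 m (\sum_(j < n) A (r, th j)).
  move=> /andP[r1 r2].
  have -> : m = \sum_(j < n) (fun r => U (r, th j)).
    by apply/funext => x; rewrite /m fct_sumE.
  apply: is_derive_sum => j.
  have [||h _ _] // := H r (th j); first by rewrite (lt_le_trans rho0).
have [x||c cin Ec] := @MVT_segment R m (fun r => \sum_(j < n) A (r, th j)) _ _ (ltW rhor).
- by move=> /subset_itv_oo_cc xin; apply: dm; rewrite in_itv in xin.
- apply: derivable_within_continuous => y xin.
  by have [] := dm y; first by rewrite in_itv in xin.
have b1 : `|m r0 - m rho| <= n%:R * (e * r0).
  rewrite Ec normrM mulrA ler_pM //; first by apply: sumA; rewrite in_itv in cin.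
  by rewrite ger0_norm ?subr_ge0 ?ltW // ltrBlDr ltrDl.
have b2 : `|m r0| <= n%:R * M.
  apply: le_trans (ler_norm_sum _ _ _) _.
  apply: le_trans (ler_sum _ (fun (j : 'I_n) _ => HM (th j) (thin j))) _.
  by rewrite sumr_const card_ord mulr_natl.
have b3 : `|m rho - n%:R * u1| <= n%:R * e.
  have -> : n%:R * u1 = \sum_(j < n) u1 by rewrite sumr_const card_ord mulr_natl.
  have hrho : 0 < rho < d by rewrite rho0.
  rewrite -sumrB; apply: le_trans (ler_norm_sum _ _ _) _.
  apply: le_trans (ler_sum _ (fun (j : 'I_n) _ => Hd rho (th j) hrho)) _.
  by rewrite sumr_const card_ord mulr_natl.
rewrite -(ler_pM2l nR).
have -> : n%:R * `|u1| = `|n%:R * u1| by rewrite normrM normr_nat.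
have -> : n%:R * u1 = m r0 - (m r0 - m rho) - (m rho - n%:R * u1) by ring.
apply: le_trans (ler_normB _ _) _.
apply: le_trans (lerD (ler_normB _ _) b3) _.
apply: le_trans (lerD (lerD b2 b1) (lexx _)) _.
by rewrite le_eqVlt; apply/orP; left; apply/eqP; ring.
Qed.

End MeanValue.

(** * Complex differentiability on [R * R] and its calculus *)

Section Holomorphic.
Variable R : realType.
Local Notation C := (R * R)%type.

Lemma is_diff_near (V W : normedModType R) (f df : V -> W) z : is_diff z f df ->
  forall e, 0 < e -> \forall h \near 0, `|f (h + z) - f z - df h| <= e * `|h|.
Proof.
move=> [dfz <-] e e0; have /diff_locally/eqaddoP/(_ _ e0) := dfz.
apply: filterS => h; rewrite /= !fctE.
by have -> : f (h + z) - (f z + 'd f z h) = f (h + z) - f z - 'd f z h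
  by rewrite opprD addrA.
Qed.

Lemma near_is_diff (V W : normedModType R) (f df : V -> W) z :
  linear df -> continuous df ->
  (forall e, 0 < e -> \forall h \near 0, `|f (h + z) - f z - df h| <= e * `|h|) ->
  is_diff z f df.
Proof.
move=> ldf cdf H.
pose lM := GRing.isLinear.Build _ _ _ _ _ ldf.
pose L : {linear V -> W} := HB.pack df lM.
have E : f \o shift z = cst (f z) + L +o_ 0 id.
  apply/eqaddoP => e e0; apply: filterS (H e e0) => h; rewrite /= !fctE.
  by rewrite opprD addrA.
have D : 'd f z = df :> (V -> W) := @diff_unique _ _ _ f L z cdf E.
by apply: DiffDef => //; apply/diff_locallyP; rewrite D.
Qed.

Definition cmul (z w : C) : C := (z.1 * w.1 - z.2 * w.2, z.1 * w.2 + z.2 * w.1).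
Definition normC2 (z : C) : R := z.1 ^+ 2 + z.2 ^+ 2.
(** Division by zero being zero, [cinv 0 = 0], and [normC2V] holds for every z. *)
Definition cinv (z : C) : C := (z.1 / normC2 z, - z.2 / normC2 z).

Lemma normC2_ge0 z : 0 <= normC2 z.
Proof. by rewrite addr_ge0 ?sqr_ge0. Qed.

Lemma normC2_eq0 z : (normC2 z == 0) = (z == 0).
Proof.
by rewrite /normC2 paddr_eq0 ?sqr_ge0 // !sqrf_eq0; case: z.
Qed.

Lemma normC2M z w : normC2 (cmul z w) = normC2 z * normC2 w.
Proof. by rewrite /normC2 /cmul /=; ring. Qed.

Lemma normC2V z : normC2 (cinv z) = (normC2 z)^-1.
Proof.
have [/eqP|] := eqVneq (normC2 z) 0.
  rewrite normC2_eq0 => /eqP ->.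
  by rewrite /normC2 /cinv /= oppr0 !mul0r expr0n /= addr0 invr0.
move=> z0; rewrite [LHS]/normC2 /cinv /= !expr_div_n sqrrN -mulrDl -/(normC2 z).
by rewrite expr2 invfM mulrA divff // mul1r.
Qed.

Lemma cmulV z : z != 0 -> cmul z (cinv z) = (1, 0).
Proof.
rewrite -normC2_eq0 /normC2 => z0; rewrite /cmul /cinv /normC2 /=.
by congr pair; field.
Qed.

(** The Cauchy-Riemann equations are contained in the demand that the real differential be
    multiplication by d. The two components are kept apart so that the product and inverse rules for
    real-valued functions apply. *)
Definition cdiff (u : C -> C) (z d : C) : Prop :=
  is_diff z (fun x => (u x).1) (fun h => (cmul d h).1) /\
  is_diff z (fun x => (u x).2) (fun h => (cmul d h).2).

(* du is the complex derivative of u as a function; only its continuity at z is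
   required. *)
Definition hol (u du : C -> C) (z : C) : Prop :=
  cdiff u z (du z) /\ {for z, continuous du}.

Lemma cvgC (T : Type) (F : set_system T) {FF : Filter F} (u : T -> C) (l : C) :
  u @ F --> l <->
  ((u x).1 @[x --> F] --> l.1 /\ (u x).2 @[x --> F] --> l.2).
Proof.
split=> [ul|[u1 u2]].
  by case: l ul => l1 l2 ul; split;
    [exact: (cvg_comp u fst ul (@cvg_fst _ _ (nbhs l1) (nbhs l2) _))
    |exact: (cvg_comp u snd ul (@cvg_snd _ _ (nbhs l1) (nbhs l2) _))].
have -> : u = (fun x => ((u x).1, (u x).2)) by apply/funext => x; case: (u x).
by case: l u1 u2 => l1 l2 /= u1 u2;
  exact: (@cvg_pair _ _ _ F (nbhs l1) (nbhs l2) _ _ _ _ _ u1 u2).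
Qed.

Section Limits.
Context {T : Type} {F : set_system T} {FF : Filter F}.

Lemma cvg_normC2 (u : T -> C) (l : C) :
  u @ F --> l -> normC2 (u x) @[x --> F] --> normC2 l.
Proof.
by move=> /cvgC[u1 u2]; rewrite /normC2 !expr2; apply: cvgD; apply: cvgM.
Qed.

Lemma cvg_cadd (u v : T -> C) (l m : C) :
  u @ F --> l -> v @ F --> m -> u x + v x @[x --> F] --> l + m.
Proof. by move=> ul vm; apply: cvgD. Qed.

Lemma cvg_cmul (u v : T -> C) (l m : C) :
  u @ F --> l -> v @ F --> m -> cmul (u x) (v x) @[x --> F] --> cmul l m.
Proof.
move=> /cvgC[u1 u2] /cvgC[v1 v2]; apply/cvgC; split => /=.
  by apply: cvgB; apply: cvgM.
by apply: cvgD; apply: cvgM.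
Qed.

Lemma cvg_cinv (u : T -> C) (l : C) : l != 0 ->
  u @ F --> l -> cinv (u x) @[x --> F] --> cinv l.
Proof.
rewrite -normC2_eq0 => l0 ul; have /cvgC[u1 u2] := ul; apply/cvgC; split => /=.
  by apply: cvgM => //; apply: cvgV => //; apply: cvg_normC2.
apply: cvgM => //; first exact: cvgN.
by apply: cvgV => //; apply: cvg_normC2.
Qed.

End Limits.

Lemma cdiff_continuous u z d : cdiff u z d -> {for z, continuous u}.
Proof. by move=> [[/differentiable_continuous u1 _] [/differentiable_continuous u2 _]]; apply/cvgC. Qed.

Lemma cdiff_cst c z : cdiff (fun=> c) z 0.
Proof.
split; apply: (is_diff_eq (is_diff_cst _ _)); apply/funext => h;
  by rewrite /cmul (_ : 0 = (0, 0) :> C) //= !mul0r ?subrr ?addr0.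
Qed.

Lemma is_diff_linear (V W : normedModType R) (f : {linear V -> W}) z :
  continuous f -> is_diff z f f.
Proof. by move=> cf; apply: DiffDef; [exact: linear_differentiable|exact: diff_lin]. Qed.

Lemma is_diff_fst (V W : normedModType R) (z : V * W) : is_diff z fst fst.
Proof. by apply: is_diff_linear => -[x y]; exact: (@cvg_fst _ _ (nbhs x) (nbhs y) _). Qed.

Lemma is_diff_snd (V W : normedModType R) (z : V * W) : is_diff z snd snd.
Proof. by apply: is_diff_linear => -[x y]; exact: (@cvg_snd _ _ (nbhs x) (nbhs y) _). Qed.

Lemma cdiff_id z : cdiff id z (1, 0).
Proof.
split.
  apply: (is_diff_eq (is_diff_fst z)); apply/funext => h.
  by rewrite /cmul /= mul1r mul0r subr0.
apply: (is_diff_eq (is_diff_snd z)); apply/funext => h.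
by rewrite /cmul /= mul1r mul0r addr0.
Qed.

Lemma cdiffD u v z d e : cdiff u z d -> cdiff v z e ->
  cdiff (fun x => u x + v x) z (d + e).
Proof.
move=> [u1 u2] [v1 v2]; split; [apply: (is_diff_eq (is_diffD u1 v1))|
  apply: (is_diff_eq (is_diffD u2 v2))]; apply/funext => h;
  by rewrite !fctE /cmul /=; ring.
Qed.

Lemma cdiffM u v z d e : cdiff u z d -> cdiff v z e ->
  cdiff (fun x => cmul (u x) (v x)) z (cmul (u z) e + cmul d (v z)).
Proof.
move=> [u1 u2] [v1 v2]; split.
  apply: (is_diff_eq (is_diffB (is_diffM u1 v1) (is_diffM u2 v2))).
  by apply/funext => h; rewrite !fctE /cmul /= /GRing.scale /=; ring.
apply: (is_diff_eq (is_diffD (is_diffM u1 v2) (is_diffM u2 v1))).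
by apply/funext => h; rewrite !fctE /cmul /= /GRing.scale /=; ring.
Qed.

Lemma cdiffV u z d : cdiff u z d -> u z != 0 ->
  cdiff (fun x => cinv (u x)) z (- cmul (cmul (cinv (u z)) (cinv (u z))) d).
Proof.
move=> [u1 u2]; rewrite -normC2_eq0 => uz0.
pose n x := normC2 (u x).
have dn : is_diff z n (fun h => 2 * ((u z).1 * (cmul d h).1 + (u z).2 * (cmul d h).2)).
  have -> : n = (fun x => (u x).1) * (fun x => (u x).1) + (fun x => (u x).2) * (fun x => (u x).2).
    by apply/funext => x; rewrite /n /normC2 !fctE !expr2.
  apply: (is_diff_eq (is_diffD (is_diffM u1 u1) (is_diffM u2 u2))).
  by apply/funext => h; rewrite !fctE /GRing.scale /=; ring.
have dV : is_diff z (fun x => (n x)^-1) (fun h => - (n z) ^- 2 *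
    (2 * ((u z).1 * (cmul d h).1 + (u z).2 * (cmul d h).2))).
  have [dn1 dn2] := dn; apply: DiffDef; first exact: differentiableV.
  by rewrite diffV // dn2.
split.
  apply: (is_diff_eq (is_diffM u1 dV)); apply/funext => h.
  by move: uz0; rewrite !fctE /cmul /cinv /GRing.scale /= /n /normC2 => uz0; field.
apply: (is_diff_eq (is_diffM (is_diffN u2) dV)); apply/funext => h.
by move: uz0; rewrite !fctE /cmul /cinv /GRing.scale /= /n /normC2 => uz0; field.
Qed.

End Holomorphic.

(** * Circles, and a minimum principle at their center *)

Section CenterMin.
Variable R : realType.
Local Notation C := (R * R)%type.

Lemma is_derive_curve (V W : normedModType R) (f df : V -> W) (g : R -> V) t dg :
  is_diff (g t) f df -> is_derive t 1 g dg -> is_derive t 1 (f \o g) (df dg).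
Proof.
move=> ff [gd gE].
have gdiff : differentiable g t by apply/derivable1_diffP.
have [fd fE] := is_diff_comp (differentiableP gdiff) ff.
split; first exact/derivable1_diffP.
by rewrite deriveE // fE /= -gE deriveE.
Qed.

Lemma is_derive_pair (V W : normedModType R) (f : R -> V) (g : R -> W) (t : R) df dg :
  is_derive t 1 f df -> is_derive t 1 g dg ->
  is_derive t 1 (fun t => (f t, g t)) (df, dg).
Proof.
move=> [fd <-] [gd <-].
have fD : differentiable f t by apply/derivable1_diffP.
have gD : differentiable g t by apply/derivable1_diffP.
have D := differentiable_pair fD gD.
split; first exact/derivable1_diffP.
by rewrite deriveE // diff_pair // !deriveE.
Qed.

Lemma holD u du v dv (z : C) : hol u du z -> hol v dv z ->
  hol (fun x => u x + v x) (fun x => du x + dv x) z.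
Proof.
by move=> [u1 u2] [v1 v2]; split; [exact: cdiffD|apply: cvg_cadd].
Qed.

Lemma holM u du v dv (z : C) : hol u du z -> hol v dv z ->
  hol (fun x => cmul (u x) (v x)) (fun x => cmul (u x) (dv x) + cmul (du x) (v x)) z.
Proof.
move=> [u1 u2] [v1 v2]; split; first exact: cdiffM.
have cu := cdiff_continuous u1; have cv := cdiff_continuous v1.
by apply: cvg_cadd; apply: cvg_cmul.
Qed.

Lemma holV u du (z : C) : hol u du z -> u z != 0 ->
  hol (fun x => cinv (u x)) (fun x => - cmul (cmul (cinv (u x)) (cinv (u x))) (du x)) z.
Proof.
move=> [u1 u2] uz0; split; first exact: cdiffV.
have cu := cdiff_continuous u1.
have ci : cinv (u x) @[x --> z] --> cinv (u z) by apply: cvg_cinv.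
by apply: cvgN; apply: cvg_cmul => //; apply: cvg_cmul.
Qed.

Lemma hol_cst c (z : C) : hol (fun=> c) (fun=> 0) z.
Proof. by split; [exact: cdiff_cst|exact: cvg_cst]. Qed.

Lemma hol_id (z : C) : hol id (fun=> (1, 0)) z.
Proof. by split; [exact: cdiff_id|exact: cvg_cst]. Qed.

Definition circle (c : C) (r t : R) : C := (c.1 + r * cos t, c.2 + r * sin t).

Lemma circle_neq c r t : 0 < r -> circle c r t != c.
Proof.
case: c => c1 c2 r0; apply/eqP; rewrite /circle /= => -[e1 e2].
have h1 : r * cos t = 0 by apply: (addrI c1); rewrite addr0.
have h2 : r * sin t = 0 by apply: (addrI c2); rewrite addr0.
have : r ^+ 2 * (cos t ^+ 2 + sin t ^+ 2) = 0.
  by rewrite mulrDr -!exprMn h1 h2 expr0n addr0.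
by rewrite cos2Dsin2 mulr1 => /eqP; rewrite sqrf_eq0 gt_eqF.
Qed.

Lemma continuous_circle (c : C) r t : (fun p : R * R => circle c p.1 p.2) @ (r, t) --> circle c r t.
Proof.
have c1 : (fun p : R * R => p.1) @ (r, t) --> r by exact: (@cvg_fst _ _ (nbhs r) (nbhs t) _).
have c2 : (fun p : R * R => p.2) @ (r, t) --> t by exact: (@cvg_snd _ _ (nbhs r) (nbhs t) _).
apply/cvgC; split => /=; apply: cvgD; (try exact: cvg_cst); apply: cvgM => //.
  by apply: (cvg_comp _ _ c2); apply: continuous_cos.
by apply: (cvg_comp _ _ c2); apply: continuous_sin.
Qed.

Lemma ball_circle (c : C) r t d : 0 < r < d -> ball c d (circle c r t).
Proof.
move=> /andP[r0 rd]; rewrite /ball /= /prod_ball /ball /= !opprD !addrA !subrr !sub0r !normrN !normrM (gtr0_norm r0).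
have hc : `|cos t| <= 1 by rewrite ler_norml cos_geN1 cos_le1.
have hs : `|sin t| <= 1 by rewrite ler_norml sin_geN1 sin_le1.
by split; apply: le_lt_trans rd; rewrite ger_pMr.
Qed.

Lemma normC2_ge_sqr1 (z : C) : `|z.1| ^+ 2 <= normC2 z.
Proof. by rewrite real_normK ?num_real // lerDl sqr_ge0. Qed.

(** [polar_mean_value] for the real part U and the imaginary part V of u in polar coordinates: with
    A = Re (u' e^{it}) the Cauchy-Riemann equations read U_r = A and V_t = r A. At c itself only the
    limit u1 is known. *)
Lemma mean_value_center (u du : C -> C) (c u1 : C) (r0 M : R) : 0 < r0 ->
  (forall r t, 0 < r <= r0 -> hol u du (circle c r t)) ->
  u @ c^' --> u1 ->
  (forall t, 0 <= t <= pi *+ 2 -> `|(u (circle c r0 t)).1| <= M) ->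
  `|u1.1| <= M.
Proof.
move=> r00 hu ul uM.
pose A p := (cmul (du (circle c p.1 p.2)) (cos p.2, sin p.2)).1.
refine (@polar_mean_value R (fun p => (u (circle c p.1 p.2)).1)
  (fun p => (u (circle c p.1 p.2)).2) A r0 (pi *+ 2) u1.1 M r00 _ _ _ _ uM).
- by rewrite pmulrn_lgt0 // pi_gt0.
- move=> r t rr _; have [[h1 h2] hc] := hu r t rr; split.
  + have dr : is_derive r 1 (fun r => circle c r t) (cos t, sin t).
      apply: is_derive_pair.
        by apply: is_derive_eq; rewrite /GRing.scale /=; ring.
      by apply: is_derive_eq; rewrite /GRing.scale /=; ring.
    exact: (is_derive_curve (g := fun r => circle c r t) h1 dr).
  + have dt : is_derive t 1 (fun t => circle c r t) (- (r * sin t), r * cos t).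
      apply: is_derive_pair.
        by apply: is_derive_eq; rewrite /GRing.scale /=; ring.
      by apply: is_derive_eq; rewrite /GRing.scale /=; ring.
    apply: is_derive_eq; first exact: (is_derive_curve (g := fun t => circle c r t) h2 dt).
    by rewrite /A /cmul /=; ring.
  + have c2 : (fun p : R * R => p.2) @ (r, t) --> t by exact: (@cvg_snd _ _ (nbhs r) (nbhs t) _).
    have : cmul (du (circle c p.1 p.2)) (cos p.2, sin p.2) @[p --> (r, t)]
        --> cmul (du (circle c r t)) (cos t, sin t); last by move=> /cvgC[].
    apply: cvg_cmul.
      exact: (@cvg_comp _ _ _ _ du _ _ _ (@continuous_circle c r t) hc).
    apply/cvgC; split => /=.
      by apply: (cvg_comp _ _ c2); apply: continuous_cos.
    by apply: (cvg_comp _ _ c2); apply: continuous_sin.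
- by move=> r /=; rewrite /circle cos2pi sin2pi cos0 sin0.
- move=> e e0; have [ul1 _] := (cvgC _ _).1 ul.
  have /cvgrPdist_le/(_ _ e0)/nbhs_ballP[d /= d0 H] := ul1.
  exists d => // r t rd; rewrite distrC; apply: H; first exact: ball_circle.
  by apply: circle_neq; case/andP: rd.
Qed.

(** The mean value bound is applied to d / w, which tends to 1 at c and has squared modulus at most
    |d|^2 / m on the outer circle. Here m bounds squared moduli. *)
Lemma center_min (w dw : C -> C) (c d : C) (r0 m : R) : 0 < r0 -> 0 < m ->
  (forall r t, 0 < r <= r0 -> hol w dw (circle c r t) /\ w (circle c r t) != 0) ->
  w @ c^' --> d -> d != 0 ->
  (forall t, 0 <= t <= pi *+ 2 -> m <= normC2 (w (circle c r0 t))) ->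
  m <= normC2 d.
Proof.
move=> r00 m0 hw wd d0 wm.
pose u x := cmul d (cinv (w x)).
have := @mean_value_center u _ c (1, 0) r0 (Num.sqrt (normC2 d / m)) r00
  (fun r t rr => holM (hol_cst d _) (holV (hw r t rr).1 (hw r t rr).2)).
have ul : u @ c^' --> ((1, 0) : C).
  by rewrite -(cmulV d0); apply: cvg_cmul; [exact: cvg_cst|exact: cvg_cinv].
move=> /(_ ul) H.
have : `|(1:R)| <= Num.sqrt (normC2 d / m).
  apply: H => t ht; rewrite -sqrtr_sqr; apply: ler_wsqrtr.
  apply: (@le_trans _ _ (normC2 (u (circle c r0 t)))).
    by rewrite -real_normK ?num_real // normC2_ge_sqr1.
  rewrite normC2M normC2V ler_wpM2l ?normC2_ge0 // lef_pV2 ?posrE ?wm //.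
  by rewrite (lt_le_trans m0) // wm.
rewrite normr1 -sqrtr1 ler_sqrt; last by rewrite divr_ge0 ?normC2_ge0 // ltW.
by rewrite ler_pdivlMr // mul1r.
Qed.

Lemma cdiff_quotient (g : C -> C) (c d : C) : cdiff g c d -> g c = 0 ->
  cmul (g z) (cinv (z - c)) @[z --> c^'] --> d.
Proof.
move=> [g1 g2] gc0.
(* The fraction is the real part of (g(z) - d h) conj(h) / |h|^2 with h = z - c; exchanging p with q
   and negating h2 gives the imaginary part. The maximum is the norm of [R * R]; its square is at
   most |h|^2, so each of the two terms contributes at most e. *)
have key (p q h1 h2 x y e : R) : 0 < h1 ^+ 2 + h2 ^+ 2 -> 0 <= e ->
    `|p - x| <= e * Num.max `|h1| `|h2| -> `|q - y| <= e * Num.max `|h1| `|h2| ->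
    `|((p - x) * h1 + (q - y) * h2) / (h1 ^+ 2 + h2 ^+ 2)| <= 2 * e.
  move=> h0 e0 px qy; set M := Num.max _ _ in px qy.
  have M1 : `|h1| <= M by rewrite le_max lexx.
  have M2 : `|h2| <= M by rewrite le_max lexx orbT.
  have M0 : 0 <= M by apply: le_trans M1.
  have MM : M ^+ 2 <= h1 ^+ 2 + h2 ^+ 2.
    rewrite /M /Num.max; case: ifP => _; rewrite real_normK ?num_real //.
      by rewrite lerDr sqr_ge0.
    by rewrite lerDl sqr_ge0.
  rewrite normrM normfV (gtr0_norm h0) ler_pdivrMr //.
  apply: le_trans (ler_normD _ _) _; rewrite !normrM.
  apply: le_trans (_ : e * M * M + e * M * M <= _).
    by apply: lerD; apply: ler_pM.
  have -> : e * M * M + e * M * M = 2 * e * M ^+ 2 by ring.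
  by apply: ler_wpM2l => //; rewrite mulr_ge0.
have close e : 0 < e -> \forall z \near c^', let q := cmul (g z) (cinv (z - c)) in
    `|d.1 - q.1| <= e /\ `|d.2 - q.2| <= e.
  move=> e0; have e20 : 0 < e / 2 by rewrite divr_gt0.
  have N1 := is_diff_near g1 e20; have N2 := is_diff_near g2 e20.
  rewrite gc0 in N1 N2.
  have sub0 : z - c @[z --> c] --> (0 : C).
    by rewrite -[X in _ --> X](subrr c); apply: cvgB; [exact: cvg_id|exact: cvg_cst].
  have {}N1 : \forall z \near c^', `|(g (z - c + c)).1 - 0 - (cmul d (z - c)).1|
    <= e / 2 * `|z - c| by exact: nbhs_dnbhs (sub0 _ N1).
  have {}N2 : \forall z \near c^', `|(g (z - c + c)).2 - 0 - (cmul d (z - c)).2|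
    <= e / 2 * `|z - c| by exact: nbhs_dnbhs (sub0 _ N2).
  have N3 : \forall z \near c^', z != c by exact: nbhs_dnbhs_neq.
  apply: filterS3 N1 N2 N3 => z; rewrite subrK !subr0 -subr_eq0 -normC2_eq0.
  move: (z - c) => -[h1 h2] px qy h0.
  have hpos : 0 < h1 ^+ 2 + h2 ^+ 2 by rewrite lt_def h0 (normC2_ge0 (h1, h2)).
  rewrite /normC2 /= in h0.
  split.
    have := key _ _ _ _ _ _ _ hpos (ltW e20) px qy.
    rewrite mulrCA divff // mulr1; apply: le_trans.
    rewrite le_eqVlt; apply/orP; left; apply/eqP; rewrite -[LHS]normrN; congr `|_|.
    by rewrite /cmul /cinv /normC2 /=; field.
  have := key (g z).2 (g z).1 h1 (- h2) (cmul d (h1, h2)).2 (cmul d (h1, h2)).1 (e / 2).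
  rewrite sqrrN normrN => /(_ hpos (ltW e20) qy px).
  rewrite mulrCA divff // mulr1; apply: le_trans.
  rewrite le_eqVlt; apply/orP; left; apply/eqP; rewrite -[LHS]normrN; congr `|_|.
  by rewrite /cmul /cinv /normC2 /=; field.
apply/cvgC; split; apply/cvgrPdist_le => e e0; apply: filterS (close e e0) => z /= -[] //.
Qed.

End CenterMin.

(** * Stem functions in coordinates *)

Section Partials.
Variable R : realType.
Local Notation C := (R * R)%type.

Lemma is_derive_linear (U V W : normedModType R) (L : V -> W) (f : U -> V) z v df :
  linear L -> continuous L -> is_derive z v f df ->
  is_derive z v (fun x => L (f x)) (L df).
Proof.
move=> lL cL [{}df <-].
pose lM := GRing.isLinear.Build _ _ _ _ _ lL.
pose L' : {linear V -> W} := HB.pack L lM.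
have lB x y : L (x - y) = L x - L y := linearB L' x y.
have lZ a x : L (a *: x) = a *: L x := linearZZ L' a x.
have E : h^-1 *: (L (f (h *: v + z)) - L (f z)) @[h --> 0^'] --> L ('D_v f z).
  have -> : (fun h => h^-1 *: (L (f (h *: v + z)) - L (f z))) =
      L \o (fun h => h^-1 *: (f (h *: v + z) - f z)).
    by apply/funext => h /=; rewrite lZ lB.
  have df' : h^-1 *: (f (h *: v + z) - f z) @[h --> 0^'] --> 'D_v f z := df.
  by apply: cvg_comp df' _; exact: cL.
split; first by apply/cvg_ex; exists (L ('D_v f z)).
by apply: cvg_lim.
Qed.

(** Allows increments of either sign, so that [C1_is_diff] needs no case split on the direction of
    its steps. *)
Lemma MVT_abs (g dg : R -> R) (a h : R) :
  (forall x, `|x - a| <= `|h| -> is_derive x 1 g (dg x)) ->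
  exists2 c, `|c - a| <= `|h| & g (h + a) - g a = dg c * h.
Proof.
move=> H; have [h0|h0] := leP 0 h.
  have ah : a <= h + a by rewrite lerDr.
  have sub x : x \in `[a, h + a]%R -> `|x - a| <= `|h|.
    by rewrite in_itv /= => /andP[x1 x2]; rewrite !ger0_norm ?subr_ge0 // lerBlDr.
  have [x xin||c cin ->] := @MVT_segment R g dg _ _ ah.
  - by apply: H; apply: sub; apply: subset_itv_oo_cc.
  - by apply: derivable_within_continuous => x xin; have [] := H x (sub _ xin).
  - by exists c; [exact: sub|rewrite addrK].
have ah : h + a <= a by rewrite gerDr ltW.
have sub x : x \in `[h + a, a]%R -> `|x - a| <= `|h|.
  rewrite in_itv /= => /andP[x1 x2]; rewrite ler0_norm ?subr_le0 // ltr0_norm //.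
  by lra.
have [x xin||c cin E] := @MVT_segment R g dg _ _ ah.
- by apply: H; apply: sub; apply: subset_itv_oo_cc.
- by apply: derivable_within_continuous => x xin; have [] := H x (sub _ xin).
- by exists c; [exact: sub|rewrite -opprB E; ring].
Qed.

Lemma is_derive_partial1 (p : C -> R) x y d :
  is_derive (x, y) ((1, 0) : C) p d -> is_derive x 1 (fun x => p (x, y)) d.
Proof.
have E : (fun h : R => h^-1 *: ((p \o shift (x, y)) (h *: (1, 0)) - p (x, y))) =
    (fun h : R => h^-1 *: (((fun x => p (x, y)) \o shift x) (h *: 1) - p (x, y))).
  apply/funext => h; congr (_ *: (p _ - _)); apply/pair_equal_spec.
  by rewrite /= scaler0 add0r.
by move=> [d1 d2]; split; rewrite /derivable /derive /= -/E; rewrite -E.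
Qed.

Lemma is_derive_partial2 (p : C -> R) x y d :
  is_derive (x, y) ((0, 1) : C) p d -> is_derive y 1 (fun y => p (x, y)) d.
Proof.
have E : (fun h : R => h^-1 *: ((p \o shift (x, y)) (h *: (0, 1)) - p (x, y))) =
    (fun h : R => h^-1 *: (((fun y => p (x, y)) \o shift y) (h *: 1) - p (x, y))).
  apply/funext => h; congr (_ *: (p _ - _)); apply/pair_equal_spec.
  by rewrite /= scaler0 add0r.
by move=> [d1 d2]; split; rewrite /derivable /derive /= -/E; rewrite -E.
Qed.

(** The increment is split into a horizontal step at height z2 + h2 and a vertical step at abscissa
    z1. The mean value theorem turns each into a partial derivative at a nearby point, which is
    within e / 2 of its value at z. *)
Lemma C1_is_diff (p pa pb : C -> R) (z : C) :
  (\forall x \near z, is_derive x ((1, 0) : C) p (pa x) /\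
                      is_derive x ((0, 1) : C) p (pb x)) ->
  {for z, continuous pa} -> {for z, continuous pb} ->
  is_diff z p (fun h => h.1 * pa z + h.2 * pb z).
Proof.
move=> dp ca cb; apply: near_is_diff.
- by move=> a x y /=; rewrite /GRing.scale /=; ring.
- move=> x; have [c1 c2] := (cvgC id x).1 cvg_id.
  by apply: cvgD; apply: cvgM => //; exact: cvg_cst.
move=> e e0; have e20 : 0 < e / 2 by rewrite divr_gt0.
move/cvgrPdist_le/(_ _ e20) in ca; move/cvgrPdist_le/(_ _ e20) in cb.
have /nbhs_ballP[d /= d0 H] : \forall x \near z, [/\
    is_derive x ((1, 0) : C) p (pa x), is_derive x ((0, 1) : C) p (pb x),
    `|pa z - pa x| <= e / 2 & `|pb z - pb x| <= e / 2].
  by apply: filterS3 dp ca cb => x [].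
have {}H x y : `|x - z.1| < d -> `|y - z.2| < d -> [/\
    is_derive (x, y) ((1, 0) : C) p (pa (x, y)), is_derive (x, y) ((0, 1) : C) p (pb (x, y)),
    `|pa (x, y) - pa z| <= e / 2 & `|pb (x, y) - pb z| <= e / 2].
  move=> hx hy; rewrite (distrC (pa _)) (distrC (pb _)); apply: H.
  by split; rewrite /ball /= distrC.
apply/nbhs_ballP; exists d => // h [/=]; rewrite /ball /= !sub0r !normrN => h1d h2d.
case: z h {dp ca cb} H h1d h2d => z1 z2 [h1 h2] /= H h1d h2d.
have k0 : `|(0:R)| < d by rewrite normr0.
have [|c1 c1h E1] := @MVT_abs (fun x => p (x, h2 + z2)) (fun x => pa (x, h2 + z2)) z1 h1.
  move=> x xh; apply: is_derive_partial1.
  by have [] // := H x (h2 + z2); [apply: le_lt_trans h1d|rewrite addrK].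
have [|c2 c2h E2] := @MVT_abs (fun y => p (z1, y)) (fun y => pb (z1, y)) z2 h2.
  move=> x xh; apply: is_derive_partial2.
  by have [] // := H z1 x; [rewrite subrr|apply: le_lt_trans h2d].
have [|_ _ A1 _] := H c1 (h2 + z2) (le_lt_trans c1h h1d); first by rewrite addrK.
have [|_ _ _ A2] := H z1 c2 _ (le_lt_trans c2h h2d); first by rewrite subrr.
have -> : p ((h1, h2) + (z1, z2)) - p (z1, z2) - (h1 * pa (z1, z2) + h2 * pb (z1, z2)) =
   (pa (c1, h2 + z2) - pa (z1, z2)) * h1 + (pb (z1, c2) - pb (z1, z2)) * h2.
  have -> : p ((h1, h2) + (z1, z2)) = p (h1 + z1, h2 + z2) by [].
  rewrite -(subrK (p (z1, h2 + z2)) (p (h1 + z1, _))) E1 -addrA -addrA [X in _ + X]addrA E2.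
  by ring.
apply: le_trans (ler_normD _ _) _; rewrite !normrM.
have -> : `|(h1, h2)| = Num.max `|h1| `|h2| by [].
rewrite (splitr e) mulrDl; apply: lerD; apply: ler_pM => //.
  by rewrite le_max lexx.
by rewrite le_max lexx orbT.
Qed.

End Partials.

Section Stem.
Variable R : realType.
Local Notation C := (R * R)%type.
Local Notation H := (quat R).
Local Notation HC := (quat R * quat R)%type.

Lemma continuous_qcoord k : continuous (fun q : H => qcoord q k).
Proof. by move=> q; apply: differentiable_continuous; apply: differentiable_coord. Qed.

Lemma qcoordN (q : H) k : qcoord (- q) k = - qcoord q k.
Proof. by rewrite /qcoord mxE. Qed.

Lemma qcoord0 k : qcoord (0 : H) k = 0.
Proof. by rewrite /qcoord mxE. Qed.

(** Reads the complexified quaternions as C^4, so that the stem function of a slice regular function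
    becomes four holomorphic functions. *)
Definition Ccoord (w : HC) (k : nat) : C := (qcoord w.1 k, qcoord w.2 k).

(** [A] and [B] stand for the partial derivatives in alpha and beta. The Cauchy-Riemann hypothesis
    says that B = sqrt(-1) A, so in each coordinate the real differential h.1 A + h.2 B is the
    complex product of h with A. *)
Lemma hol_Ccoord (D : set C) (F A B : C -> HC) : open D ->
  (forall z, D z -> is_derive z ((1, 0) : C) F (A z)) ->
  (forall z, D z -> is_derive z ((0, 1) : C) F (B z)) ->
  (forall z, D z -> {for z, continuous A} /\ {for z, continuous B}) ->
  (forall z, D z -> A z + mul_sqrtN1 (B z) = 0) ->
  forall k z, D z -> hol (fun z => Ccoord (F z) k) (fun z => Ccoord (A z) k) z.
Proof.
move=> oD dA dB cAB CR k z Dz.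
have c1 : continuous (fun w : HC => qcoord w.1 k).
  move=> w; apply: (@differentiable_continuous _ _ _ w).
  apply: (@differentiable_comp _ _ H _ fst (fun q : H => qcoord q k)).
    by have [] := @is_diff_fst R H H w.
  exact: differentiable_coord.
have c2 : continuous (fun w : HC => qcoord w.2 k).
  move=> w; apply: (@differentiable_continuous _ _ _ w).
  apply: (@differentiable_comp _ _ H _ snd (fun q : H => qcoord q k)).
    by have [] := @is_diff_snd R H H w.
  exact: differentiable_coord.
have l1 : linear (fun w : HC => qcoord w.1 k).
  by move=> a x y /=; rewrite qcoordD qcoordZ.
have l2 : linear (fun w : HC => qcoord w.2 k).
  by move=> a x y /=; rewrite qcoordD qcoordZ.
have [e1 e2] : qcoord (B z).2 k = qcoord (A z).1 k /\
    qcoord (B z).1 k = - qcoord (A z).2 k.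
  have E1 : (A z).1 - (B z).2 = 0 := congr1 fst (CR z Dz).
  have E2 : (A z).2 + (B z).1 = 0 := congr1 snd (CR z Dz).
  have {}E1 : qcoord ((A z).1 - (B z).2) k = 0 by rewrite E1 qcoord0.
  have {}E2 : qcoord ((A z).2 + (B z).1) k = 0 by rewrite E2 qcoord0.
  rewrite qcoordD qcoordN in E1; rewrite qcoordD in E2.
  by split; [exact: esym (subr0_eq E1)|exact: esym (addr0_eq E2)].
have Dn : \forall x \near z, D x by apply: open_nbhs_nbhs.
have [cA cB] := cAB z Dz.
have part (L : HC -> R) : linear L -> continuous L ->
    is_diff z (fun x => L (F x)) (fun h => h.1 * L (A z) + h.2 * L (B z)).
  move=> lL cL; apply: (@C1_is_diff _ _ (fun z => L (A z)) (fun z => L (B z))).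
  - apply: filterS Dn => x Dx; have dAx := dA x Dx; have dBx := dB x Dx.
    by split; apply: is_derive_linear.
  - exact: (@continuous_comp _ _ _ A L z cA (cL _)).
  - exact: (@continuous_comp _ _ _ B L z cB (cL _)).
split; last first.
  apply/cvgC; split.
    exact: (@continuous_comp _ _ _ A (fun w : HC => qcoord w.1 k) z cA (c1 _)).
  exact: (@continuous_comp _ _ _ A (fun w : HC => qcoord w.2 k) z cA (c2 _)).
split.
  apply: (is_diff_eq (part _ l1 c1)); apply/funext => h; rewrite e2 /cmul /Ccoord.
  by move: (qcoord (A z).1 k) (qcoord (A z).2 k) => x y /=; ring.
apply: (is_diff_eq (part _ l2 c2)); apply/funext => h; rewrite e1 /cmul /Ccoord.
by move: (qcoord (A z).1 k) (qcoord (A z).2 k) => x y /=; ring.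
Qed.

Lemma hol_stem (D : set C) (F : C -> HC) : open D -> of_class_C1 D F ->
  (forall z, D z -> dbar F z = 0) ->
  forall k z, D z -> hol (fun z => Ccoord (F z) k) (fun z => Ccoord (d_alpha F z) k) z.
Proof.
move=> oD C1 db; apply: (@hol_Ccoord D F (d_alpha F) (d_beta F) oD) => z Dz.
- by have [d1 _ _ _] := C1 z Dz; split.
- by have [_ d2 _ _] := C1 z Dz; split.
- by have [_ _ c1 c2] := C1 z Dz; split.
- by have /eqP := db z Dz; rewrite scaler_eq0 invr_eq0 pnatr_eq0 /= => /eqP.
Qed.

End Stem.

(** * Quaternion algebra: scalar product, imaginary units, null vectors *)

Section QuatAlgebra.
Variable R : realType.
Local Notation C := (R * R)%type.
Local Notation H := (quat R).
Local Notation HC := (quat R * quat R)%type.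
Implicit Types (p q a b J : H).

Lemma qcoordM0 p q : qcoord (p * q) 0 = qcoord p 0 * qcoord q 0 -
  qcoord p 1 * qcoord q 1 - qcoord p 2 * qcoord q 2 - qcoord p 3 * qcoord q 3.
Proof. by rewrite [p * q]/(Defs.mulq p q) qcoord_mk. Qed.

Lemma qcoordM1 p q : qcoord (p * q) 1 = qcoord p 0 * qcoord q 1 +
  qcoord p 1 * qcoord q 0 + qcoord p 2 * qcoord q 3 - qcoord p 3 * qcoord q 2.
Proof. by rewrite [p * q]/(Defs.mulq p q) qcoord_mk. Qed.

Lemma qcoordM2 p q : qcoord (p * q) 2 = qcoord p 0 * qcoord q 2 -
  qcoord p 1 * qcoord q 3 + qcoord p 2 * qcoord q 0 + qcoord p 3 * qcoord q 1.
Proof. by rewrite [p * q]/(Defs.mulq p q) qcoord_mk. Qed.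

Lemma qcoordM3 p q : qcoord (p * q) 3 = qcoord p 0 * qcoord q 3 +
  qcoord p 1 * qcoord q 2 - qcoord p 2 * qcoord q 1 + qcoord p 3 * qcoord q 0.
Proof. by rewrite [p * q]/(Defs.mulq p q) qcoord_mk. Qed.

Definition qcoordE := (qcoordM0, qcoordM1, qcoordM2, qcoordM3, qcoordD, qcoordN,
  qcoordZ, qcoord0, qcoord_mk).

Definition qdot p q : R := qcoord p 0 * qcoord q 0 + qcoord p 1 * qcoord q 1 +
  qcoord p 2 * qcoord q 2 + qcoord p 3 * qcoord q 3.

Lemma qdot_ge0 p : 0 <= qdot p p.
Proof. by rewrite !addr_ge0 // -expr2 sqr_ge0. Qed.

Lemma qdot_eq0 p : (qdot p p == 0) = (p == 0).
Proof.
apply/eqP/eqP => [|->]; last by rewrite /qdot !qcoord0 !mul0r !addr0.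
move/eqP; rewrite /qdot -!expr2 !paddr_eq0 ?addr_ge0 ?sqr_ge0 // !sqrf_eq0.
by move=> /andP[/andP[/andP[/eqP ? /eqP ?] /eqP ?] /eqP ?];
  apply: quatP => -[|[|[|[|//]]]] _; rewrite qcoord0.
Qed.

Lemma imaginary_unitP J : imaginary_units J <-> qcoord J 0 = 0 /\ qdot J J = 1.
Proof.
rewrite /imaginary_units /= expr2; split=> [JJ|[J0 JJ]].
  have E k : qcoord (J * J) k = qcoord (- 1) k by rewrite JJ.
  have := E 3; have := E 2; have := E 1; have := E 0.
  rewrite !qcoordE //= oppr0 /qdot => e0 e1 e2 e3.
  (* Coordinates 1 to 3 of J^2 are 2 J_0 J_k. A nonzero J_0 would kill the imaginary part and leave
     J_0^2 = -1. *)
  have J0 : qcoord J 0 = 0.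
    apply/eqP/negPn/negP => n0.
    have z x : qcoord J 0 * x + x * qcoord J 0 = 0 -> x = 0.
      rewrite (mulrC x) -mulr2n => /eqP; rewrite mulrn_eq0 mulf_eq0 (negbTE n0).
      by move=> /eqP.
    have z1 : qcoord J 1 = 0 by apply: z; rewrite -[RHS]e1; ring.
    have z2 : qcoord J 2 = 0 by apply: z; rewrite -[RHS]e2; ring.
    have z3 : qcoord J 3 = 0 by apply: z; rewrite -[RHS]e3; ring.
    move: e0; rewrite z1 z2 z3 mulr0 !subr0 -expr2 => e0.
    by have := sqr_ge0 (qcoord J 0); rewrite e0 oppr_ge0 ler10.
  split=> //; move: e0; rewrite J0 !mul0r !add0r => e0.
  by apply: oppr_inj; rewrite -e0; ring.
move: JJ; rewrite /qdot J0 mulr0 add0r => JJ.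
by apply: quatP => -[|[|[|[|//]]]] _; rewrite !qcoordE //= J0 ?oppr0;
  try ring; rewrite -JJ; ring.
Qed.

(* The complex bilinear extension of the scalar product of the quaternions. *)
Definition cform (v w : HC) : C :=
  cmul (Ccoord v 0) (Ccoord w 0) + cmul (Ccoord v 1) (Ccoord w 1) +
  cmul (Ccoord v 2) (Ccoord w 2) + cmul (Ccoord v 3) (Ccoord w 3).

Lemma cformE v w :
  cform v w = (qdot v.1 w.1 - qdot v.2 w.2, qdot v.1 w.2 + qdot v.2 w.1).
Proof.
rewrite /cform /cmul /Ccoord /qdot.
by apply/pair_equal_spec; split => /=; ring.
Qed.

(** For a null vector a + sqrt(-1) b one has |a| = |b| and a orthogonal to b, so for b <> 0 the
    quaternion -a b^{-1} is purely imaginary of norm one. This turns a zero of N_c into a point of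
    the sphere where f takes the value c. *)
Lemma null_vector (v : HC) : cform v v = 0 ->
  exists2 J, imaginary_units J & v.1 + J * v.2 = 0.
Proof.
case: v => a b; rewrite cformE => -[/= /subr0_eq ab].
have -> : qdot a b + qdot b a = 2 * qdot a b by rewrite /qdot; ring.
move=> /eqP; rewrite mulf_eq0 pnatr_eq0 /= => /eqP d0.
have [b0|b0] := eqVneq b 0.
  (* If b = 0 then a = 0 as well, and any unit serves. *)
  exists (mkquat 0 1 0 0).
    apply/imaginary_unitP; rewrite /qdot !qcoordE //=; split=> //; ring.
  move: ab; rewrite b0 mulr0 addr0.
  by rewrite {2}/qdot !qcoord0 !mulr0 !addr0 => /eqP; rewrite qdot_eq0 => /eqP.
have n0 : qdot b b != 0 by rewrite qdot_eq0.
pose bc : H := mkquat (qcoord b 0) (- qcoord b 1) (- qcoord b 2) (- qcoord b 3).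
have bcb : bc * b = qdot b b *: 1.
  by apply: quatP => -[|[|[|[|//]]]] _; rewrite /bc !qcoordE //= /qdot; ring.
exists (- (qdot b b)^-1 *: (a * bc)); last first.
  rewrite -scalerAl -mulrA bcb -scalerAr mulr1 scalerA mulNr mulVf //.
  by rewrite scaleN1r subrr.
apply/imaginary_unitP; split.
  rewrite qcoordZ; have -> : qcoord (a * bc) 0 = qdot a b.
    by rewrite /bc !qcoordE //= /qdot; ring.
  by rewrite d0 mulr0.
have -> : qdot (- (qdot b b)^-1 *: (a * bc)) (- (qdot b b)^-1 *: (a * bc)) =
    (qdot b b)^-1 * (qdot b b)^-1 * qdot (a * bc) (a * bc).
  by rewrite /qdot !qcoordZ; ring.
have -> : qdot (a * bc) (a * bc) = qdot a a * qdot b b.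
  by rewrite /qdot /bc !qcoordE //=; ring.
by rewrite ab mulrA mulfVK // mulVf.
Qed.

Lemma unit_combination J K t : imaginary_units J -> imaginary_units K ->
  qdot J K = 0 -> imaginary_units (cos t *: J + sin t *: K).
Proof.
move=> /imaginary_unitP[J0 J1] /imaginary_unitP[K0 K1] JK; apply/imaginary_unitP; split.
  by rewrite !qcoordE J0 K0 !mulr0 addr0.
have -> : qdot (cos t *: J + sin t *: K) (cos t *: J + sin t *: K) =
    cos t ^+ 2 * qdot J J + sin t ^+ 2 * qdot K K + 2 * cos t * sin t * qdot J K.
  by rewrite /qdot !qcoordE; ring.
by rewrite J1 K1 JK !mulr1 mulr0 addr0 cos2Dsin2.
Qed.

Lemma orthogonal_unit J : imaginary_units J ->
  exists2 K, imaginary_units K & qdot J K = 0.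
Proof.
move=> /imaginary_unitP[J0 J1].
have [/eqP|n0] := eqVneq (qcoord J 1 ^+ 2 + qcoord J 2 ^+ 2) 0.
  rewrite paddr_eq0 ?sqr_ge0 // !sqrf_eq0 => /andP[/eqP j1 /eqP j2].
  exists (mkquat 0 1 0 0).
    by apply/imaginary_unitP; rewrite /qdot !qcoordE //=; split=> //; ring.
  by rewrite /qdot !qcoordE //= j1; ring.
set n := (X in X != 0) in n0.
have npos : 0 < n by rewrite lt_def n0 addr_ge0 ?sqr_ge0.
(* The projection of [J] to the plane of i and j, turned by a right angle and normalized; the case
   of zero projection is already settled. *)
exists ((Num.sqrt n)^-1 *: mkquat 0 (- qcoord J 2) (qcoord J 1) 0).
  apply/imaginary_unitP; rewrite /qdot !qcoordE //=; split; first by ring.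
  have -> : forall s : R, s * 0 * (s * 0) + s * - qcoord J 2 * (s * - qcoord J 2) +
    s * qcoord J 1 * (s * qcoord J 1) + s * 0 * (s * 0) = s ^+ 2 * n.
    by move=> s; rewrite /n; ring.
  by rewrite exprVn sqr_sqrtr ?(ltW npos) // mulVf.
by rewrite /qdot !qcoordE //= ; ring.
Qed.

(** On the great circle cos t J + sin t K the hypothesis reads cos t kappa + sin t <K, u> = kappa
    for small t. Comparing t with -t separates it into sin t <K, u> = 0 and (1 - cos t) kappa =
    0. *)
Lemma qdot_locally_constant J u kappa : imaginary_units J -> qcoord u 0 = 0 ->
  (\forall J' \near J, imaginary_units J' -> qdot J' u = kappa) ->
  u = 0 /\ kappa = 0.
Proof.
move=> UJ u0 near_k.
have arc K : imaginary_units K -> qdot J K = 0 -> kappa = 0 /\ qdot K u = 0.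
  move=> UK JK.
  have ct : (cos t *: J + sin t *: K) @[t --> (0:R)] --> J.
    have cJ : cos t *: J @[t --> (0:R)] --> cos 0 *: J.
      by apply: cvgZr_tmp; exact: continuous_cos.
    have cK : sin t *: K @[t --> (0:R)] --> sin 0 *: K.
      by apply: cvgZr_tmp; exact: continuous_sin.
    by have h := cvgD cJ cK; rewrite cos0 sin0 scale1r scale0r addr0 in h; exact: h.
  have near_t : \forall t \near (0:R), cos t * kappa + sin t * qdot K u = kappa.
    have k0 : qdot J u = kappa by apply: (nbhs_singleton near_k).
    have near_k' : \forall t \near (0:R), imaginary_units (cos t *: J + sin t *: K) ->
        qdot (cos t *: J + sin t *: K) u = kappa by exact: ct _ near_k.
    apply: filterS near_k' => t /(_ (unit_combination t UJ UK JK)) e.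
    by rewrite -[RHS]e -k0 /qdot !qcoordE; ring.
  have /nbhs_ballP[d /= d0 Hd] := near_t.
  (* The cap 1 lies below pi, so sin t > 0, and therefore also cos t <> 1. *)
  pose t := Num.min (d / 2) 1.
  have t0 : 0 < t by rewrite lt_min ltr01 divr_gt0.
  have td : t < d by rewrite /t gt_min; apply/orP; left; lra.
  have tpi : t < pi.
    by rewrite /t gt_min; apply/orP; right; have := pi_ge2 R; lra.
  have st : 0 < sin t by apply: sin_gt0_pi; rewrite t0.
  have := Hd t; have := Hd (- t); rewrite /ball /= !sub0r !normrN gtr0_norm // td.
  move=> /(_ isT) e1 /(_ isT) e2; rewrite cosN sinN in e1.
  have e3 : sin t * qdot K u = 0 by lra.
  move/eqP: (e3); rewrite mulf_eq0 (gt_eqF st) /= => /eqP Ku; split=> //.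
  have e4 : (1 - cos t) * kappa = 0 by lra.
  move/eqP: e4; rewrite mulf_eq0 => /orP[/eqP c1|/eqP //].
  have := cos2Dsin2 t; have -> : cos t = 1 by lra.
  by rewrite expr1n => /eqP; rewrite -subr_eq0 addrAC subrr add0r sqrf_eq0 (gt_eqF st).
have [K UK JK] := orthogonal_unit UJ.
have [k0 _] := arc K UK JK; split=> //.
have Ju : qdot J u = 0 by rewrite -k0; apply: (nbhs_singleton near_k).
apply/eqP; rewrite -qdot_eq0; apply/negPn/negP => uu.
have upos : 0 < qdot u u by rewrite lt_def uu qdot_ge0.
pose s := (Num.sqrt (qdot u u))^-1.
have s0 : s != 0 by rewrite invr_eq0 gt_eqF // sqrtr_gt0.
(* Since <J, u> = kappa = 0, a nonzero u normalizes to a unit orthogonal to [J]; the arc towards it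
   forces <u, u> = 0. *)
have [||_] := arc (s *: u).
- apply/imaginary_unitP; rewrite qcoordZ u0 mulr0; split=> //.
  have -> : qdot (s *: u) (s *: u) = s ^+ 2 * qdot u u by rewrite /qdot !qcoordZ; ring.
  by rewrite /s exprVn sqr_sqrtr ?qdot_ge0 // mulVf.
- have -> : qdot J (s *: u) = s * qdot J u by rewrite /qdot !qcoordZ; ring.
  by rewrite Ju mulr0.
have -> : qdot (s *: u) u = s * qdot u u by rewrite /qdot !qcoordZ; ring.
by move/eqP; rewrite mulf_eq0 (negbTE s0) (negbTE uu).
Qed.

(* Here w is F'(z) and (- (J' * s), s) is F(z) - f(x) for x on the sphere of z. *)
Lemma cform_locally_zero J s (w : HC) : imaginary_units J -> s != 0 ->
  (\forall J' \near J, imaginary_units J' -> cform (- (J' * s), s) w = 0) ->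
  w = 0.
Proof.
move=> UJ s0 near0; case: w near0 => a b near0.
(* [U c] is the imaginary part of c times the conjugate of s, and <s, c> is its real part. Their
   squares add up to |s|^2 |c|^2, so c = 0 once both vanish. *)
pose U (c : H) : H := mkquat 0
  (qdot (mkquat 0 1 0 0 * s) c) (qdot (mkquat 0 0 1 0 * s) c) (qdot (mkquat 0 0 0 1 * s) c).
have UE J' c : imaginary_units J' -> qdot J' (U c) = qdot (J' * s) c.
  move=> /imaginary_unitP[J0 _].
  by rewrite /U /qdot !qcoordE //= J0; ring.
(* The first component of the form gives <J', U a> = -<s, b>, the second <J', U b> = <s, a>: both
   right-hand sides are constant in J'. *)
have [Ua sb] : U a = 0 /\ - qdot s b = 0.
  apply: (@qdot_locally_constant J) => //; first by rewrite qcoord_mk.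
  apply: filterS near0 => J' h UJ'; have := h UJ'.
  rewrite cformE UE // => -[/= h1 _].
  by have e : qdot (- (J' * s)) a = - qdot (J' * s) a by [rewrite /qdot !qcoordN; ring]; lra.
have [Ub sa] : U b = 0 /\ qdot s a = 0.
  apply: (@qdot_locally_constant J) => //; first by rewrite qcoord_mk.
  apply: filterS near0 => J' h UJ'; have := h UJ'.
  rewrite cformE UE // => -[/= _ h1].
  by have e : qdot (- (J' * s)) b = - qdot (J' * s) b by [rewrite /qdot !qcoordN; ring]; lra.
have key c : U c = 0 -> qdot s c = 0 -> c = 0.
  move=> Uc sc; apply/eqP; rewrite -qdot_eq0.
  have : qdot s s * qdot c c = qdot s c ^+ 2 + qdot (U c) (U c).
    by rewrite /U /qdot !qcoordE //=; ring.
  rewrite Uc sc expr0n /= add0r (_ : qdot 0 0 = 0); last first.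
    by rewrite /qdot !qcoord0 !mulr0 !addr0.
  by move/eqP; rewrite mulf_eq0 !qdot_eq0 (negbTE s0).
by congr (_, _); apply: key => //; lra.
Qed.

End QuatAlgebra.

(** * Coordinatewise limits, and points sharing a sphere *)

Section QuatLimits.
Variable R : realType.
Local Notation C := (R * R)%type.
Local Notation H := (quat R).
Local Notation HC := (quat R * quat R)%type.

Definition qcvg (T : Type) (G : set_system T) (u : T -> H) (l : H) :=
  forall k, (k < 4)%N -> qcoord (u x) k @[x --> G] --> qcoord l k.

Section Filter.
Context {T : Type} {G : set_system T} {FG : Filter G}.
Implicit Types (u v : T -> H) (l m : H).

Lemma qcvgN u l : qcvg G u l -> qcvg G (fun x => - u x) (- l).
Proof.
move=> ul k k4; rewrite qcoordN; under eq_fun do rewrite qcoordN.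
by apply: cvgN; exact: ul.
Qed.

Lemma qcvgD u v l m : qcvg G u l -> qcvg G v m -> qcvg G (fun x => u x + v x) (l + m).
Proof.
move=> ul vm k k4; rewrite qcoordD; under eq_fun do rewrite qcoordD.
by apply: cvgD; [exact: ul|exact: vm].
Qed.

Lemma qcvgM u v l m : qcvg G u l -> qcvg G v m -> qcvg G (fun x => u x * v x) (l * m).
Proof.
move=> ul vm.
have c i j : (i < 4)%N -> (j < 4)%N -> qcoord (u x) i * qcoord (v x) j @[x --> G]
    --> qcoord l i * qcoord m j.
  by move=> i4 j4; apply: cvgM; [exact: ul|exact: vm].
case=> [|[|[|[|//]]]] _.
- rewrite qcoordM0; under eq_fun do rewrite qcoordM0.
  exact: (cvgB (cvgB (cvgB (c 0%N 0%N isT isT) (c 1%N 1%N isT isT)) (c 2%N 2%N isT isT)) (c 3%N 3%N isT isT)).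
- rewrite qcoordM1; under eq_fun do rewrite qcoordM1.
  exact: (cvgB (cvgD (cvgD (c 0%N 1%N isT isT) (c 1%N 0%N isT isT)) (c 2%N 3%N isT isT)) (c 3%N 2%N isT isT)).
- rewrite qcoordM2; under eq_fun do rewrite qcoordM2.
  exact: (cvgD (cvgD (cvgB (c 0%N 2%N isT isT) (c 1%N 3%N isT isT)) (c 2%N 0%N isT isT)) (c 3%N 1%N isT isT)).
- rewrite qcoordM3; under eq_fun do rewrite qcoordM3.
  exact: (cvgD (cvgB (cvgD (c 0%N 3%N isT isT) (c 1%N 2%N isT isT)) (c 2%N 1%N isT isT)) (c 3%N 0%N isT isT)).
Qed.

Lemma cvg_qdot u v l m : qcvg G u l -> qcvg G v m ->
  qdot (u x) (v x) @[x --> G] --> qdot l m.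
Proof.
move=> ul vm; rewrite /qdot.
have c i : (i < 4)%N -> qcoord (u x) i * qcoord (v x) i @[x --> G]
    --> qcoord l i * qcoord m i.
  by move=> i4; apply: cvgM; [exact: ul|exact: vm].
exact: (cvgD (cvgD (cvgD (c 0%N isT) (c 1%N isT)) (c 2%N isT)) (c 3%N isT)).
Qed.

Lemma cvg_cform (v w : T -> HC) (l m : HC) :
  qcvg G (fun x => (v x).1) l.1 -> qcvg G (fun x => (v x).2) l.2 ->
  qcvg G (fun x => (w x).1) m.1 -> qcvg G (fun x => (w x).2) m.2 ->
  cform (v x) (w x) @[x --> G] --> cform l m.
Proof.
move=> v1 v2 w1 w2; rewrite cformE; under eq_fun do rewrite cformE.
apply/cvgC; split => /=.
  by apply: cvgB; exact: cvg_qdot.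
by apply: cvgD; exact: cvg_qdot.
Qed.

End Filter.

(** The real parts agree, and the imaginary parts z.2 J and z'.2 J' have the same norm, which leaves
    only a sign undetermined. *)
Lemma slice_point_eq (z z' : C) (J J' : H) : imaginary_units J -> imaginary_units J' ->
  slice_point z J = slice_point z' J' -> z = z' \/ z = conjC z'.
Proof.
move=> /imaginary_unitP[J0 JJ] /imaginary_unitP[J0' JJ'] E.
have E0 : qcoord (slice_point z J) 0 = qcoord (slice_point z' J') 0 by rewrite E.
rewrite /slice_point !qcoordE //= J0 J0' !mulr0 !addr0 !mulr1 in E0.
have E2 : z.2 *: J = z'.2 *: J'.
  by move: E; rewrite /slice_point E0 => /addrI.
have : z.2 ^+ 2 = z'.2 ^+ 2.
  have e (c : R) (K : H) : qdot (c *: K) (c *: K) = c ^+ 2 * qdot K K.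
    by rewrite /qdot !qcoordZ; ring.
  by rewrite -[LHS]mulr1 -JJ -e E2 e JJ' mulr1.
move/eqP; rewrite eqf_sqr => /orP[|] /eqP E3; [left|right].
  by case: z z' E0 E3 {E E2} => ? ? [? ?] /= -> ->.
by case: z z' E0 E3 {E E2} => ? ? [? ?] /= -> ->.
Qed.

End QuatLimits.

(** * Differentials of quaternion-valued maps *)

Section QuatDiff.
Variable R : realType.
Local Notation C := (R * R)%type.
Local Notation H := (quat R).
Local Notation HC := (quat R * quat R)%type.

Lemma linear_continuous_diff (V W : normedModType R) (f : V -> W) x :
  differentiable f x -> linear ('d f x) /\ continuous ('d f x).
Proof. by move=> /diff_continuous c; split=> // a u v; rewrite linearP. Qed.

Lemma near_eq_differentiable (V W : normedModType R) (f g : V -> W) x :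
  (\forall y \near x, f y = g y) -> differentiable g x -> differentiable f x.
Proof.
move=> fg dg; have [l c] := linear_continuous_diff dg.
have [] // : is_diff x f ('d g x).
apply: near_is_diff => // e e0.
have sx : (fun h => h + x) @ (0 : V) --> x.
  by rewrite -[X in _ --> X]add0r; apply: cvgD; [exact: cvg_id|exact: cvg_cst].
have near1 : \forall h \near (0 : V), f (h + x) = g (h + x) by exact: (sx _ fg).
have near2 := is_diff_near (differentiableP dg) e0.
rewrite -(nbhs_singleton fg) in near2.
by apply: filterS2 near1 near2 => h ->.
Qed.

Lemma differentiable_qcoord (k : nat) (x : H) : differentiable (fun q : H => qcoord q k) x.
Proof. exact: differentiable_coord. Qed.

Lemma quat_sum (q : H) : q = qcoord q 0 *: (mkquat 1 0 0 0 : H) +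
  qcoord q 1 *: (mkquat 0 1 0 0 : H) +
  qcoord q 2 *: (mkquat 0 0 1 0 : H) + qcoord q 3 *: (mkquat 0 0 0 1 : H).
Proof.
by apply: quatP => -[|[|[|[|//]]]] _; rewrite !qcoordE //=; ring.
Qed.

Lemma quat_differentiable (V : normedModType R) (g : V -> H) x :
  (forall k, (k < 4)%N -> differentiable (fun y => qcoord (g y) k) x) ->
  differentiable g x.
Proof.
move=> dg.
have d k (e : H) : (k < 4)%N -> differentiable (fun y => qcoord (g y) k *: e) x.
  by move=> k4; apply: differentiableZl; apply: dg.
have -> : g = (fun y => qcoord (g y) 0 *: (mkquat 1 0 0 0 : H)) +
  (fun y => qcoord (g y) 1 *: (mkquat 0 1 0 0 : H)) +
  (fun y => qcoord (g y) 2 *: (mkquat 0 0 1 0 : H)) +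
  (fun y => qcoord (g y) 3 *: (mkquat 0 0 0 1 : H)).
  by apply/funext => y; rewrite !fctE -quat_sum.
by do 3?[apply: differentiableD]; apply: d.
Qed.

Lemma quat_is_derive (c : R -> H) (t : R) v :
  (forall k, (k < 4)%N -> is_derive t 1 (fun s => qcoord (c s) k) (qcoord v k)) ->
  is_derive t 1 c v.
Proof.
move=> dc.
have D : derivable c t 1.
  apply/derivable1_diffP; apply: quat_differentiable => k k4.
  by apply/derivable1_diffP; have [] := dc k k4.
split=> //; apply: quatP => k k4.
have lq : linear (fun q : H => qcoord q k) by move=> a x y; rewrite qcoordD qcoordZ.
have [_ <-] := is_derive_linear lq (@continuous_qcoord R k) (derivableP D).
by have [_ ->] := dc k k4.
Qed.

(** Reads the differential off curves on which f has an explicit expression [phi]: lines in a slice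
    and arcs in a sphere. *)
Lemma diff_along_curve (f : H -> H) x (c phi : R -> H) v w : differentiable f x ->
  c 0 = x -> is_derive (0 : R) 1 c v ->
  (\forall t \near (0 : R), f (c t) = phi t) ->
  (forall k, (k < 4)%N -> is_derive (0 : R) 1 (fun t => qcoord (phi t) k) (qcoord w k)) ->
  'd f x v = w.
Proof.
move=> df c0 dc fphi dphi; rewrite -c0 in df *.
have [_ <-] := is_derive_curve (differentiableP df) dc.
rewrite (near_eq_derive _ fphi).
by have [_ ->] := quat_is_derive dphi.
Qed.

Lemma linear_inj_bij (L : {linear H -> H}) :
  (forall v, L v = 0 -> v = 0) -> bijective L.
Proof.
move=> L0.
pose M : 'M[R]_4 := \matrix_(i, j) (L (delta_mx 0 i : 'rV[R]_4) : 'rV[R]_4) 0 j.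
have LM (v : H) : L v = (v : 'rV[R]_4) *m M.
  rewrite {1}[v](row_sum_delta (v : 'rV[R]_4)) linear_sum /=.
  apply/rowP => j; rewrite summxE mxE; apply: eq_bigr => i _.
  by rewrite linearZ !mxE.
have Mu : M \in unitmx.
  rewrite -row_free_unit -kermx_eq0; apply/rowV0P => v /sub_kermxP vM.
  by apply: L0; rewrite LM.
exists (fun w => (w : 'rV[R]_4) *m invmx M) => v.
  by rewrite LM mulmxK.
by rewrite LM mulmxKV.
Qed.

Lemma qcoord_le_norm (q : H) k : `|qcoord q k| <= `|q|.
Proof.
rewrite /qcoord [leRHS]/Num.Def.normr /= mx_normrE.
exact: (le_bigmax _ (fun ij : 'I_1 * 'I_4 => `|(q : 'rV[R]_4) ij.1 ij.2|) (ord0, inord k)).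
Qed.

Lemma norm_le_qcoord (q : H) e : 0 <= e ->
  (forall k, (k < 4)%N -> `|qcoord q k| <= e) -> `|q| <= e.
Proof.
move=> e0 qe; rewrite [leLHS]/Num.Def.normr /= mx_normrE.
apply: bigmax_le => // -[i j] _ /=; rewrite (ord1 i).
by have := qe j (ltn_ord j); rewrite /qcoord inord_val.
Qed.

Lemma qdot_mull (p x y : H) : qdot (p * x) (p * y) = qdot p p * qdot x y.
Proof. by rewrite /qdot !qcoordE; ring. Qed.

Lemma qdot_mulr (p x y : H) : qdot (x * p) (y * p) = qdot x y * qdot p p.
Proof. by rewrite /qdot !qcoordE; ring. Qed.

Lemma qdotD (x y z : H) : qdot (x + y) z = qdot x z + qdot y z.
Proof. by rewrite /qdot !qcoordD; ring. Qed.

Lemma qdotC (x y : H) : qdot x y = qdot y x.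
Proof. by rewrite /qdot; ring. Qed.

Lemma qdotZ (a : R) (x y : H) : qdot (a *: x) y = a * qdot x y.
Proof. by rewrite /qdot !qcoordZ; ring. Qed.

Lemma qdot0 (x : H) : qdot 0 x = 0.
Proof. by rewrite /qdot !qcoord0; ring. Qed.

Lemma qmul_eq0 (x y : H) : x * y = 0 -> y != 0 -> x = 0.
Proof.
move=> xy y0; apply/eqP; rewrite -qdot_eq0.
have : qdot (x * y) (x * y) = 0 by rewrite xy qdot0.
by rewrite qdot_mulr => /eqP; rewrite mulf_eq0 !qdot_eq0 (negbTE y0) orbF.
Qed.

Lemma is_derive_qaffine (u v : R -> H) (J a b : H) (t : R) :
  (forall k, is_derive t 1 (fun s => qcoord (u s) k) (qcoord a k)) ->
  (forall k, is_derive t 1 (fun s => qcoord (v s) k) (qcoord b k)) ->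
  forall k, (k < 4)%N ->
  is_derive t 1 (fun s => qcoord (u s + J * v s) k) (qcoord (a + J * b) k).
Proof.
move=> du dv.
have dm i j : is_derive t 1 (fun s => qcoord J i * qcoord (v s) j) (qcoord J i * qcoord b j).
  exact: (is_deriveZ (qcoord J i) (dv j)).
case=> [|[|[|[|//]]]] _.
- under eq_fun do rewrite qcoordD qcoordM0; rewrite qcoordD qcoordM0.
  exact: (is_deriveD (du _) (is_deriveB (is_deriveB (is_deriveB (dm 0 0) (dm 1 1)) (dm 2 2)) (dm 3 3)))%N.
- under eq_fun do rewrite qcoordD qcoordM1; rewrite qcoordD qcoordM1.
  exact: (is_deriveD (du _) (is_deriveB (is_deriveD (is_deriveD (dm 0 1) (dm 1 0)) (dm 2 3)) (dm 3 2)))%N.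
- under eq_fun do rewrite qcoordD qcoordM2; rewrite qcoordD qcoordM2.
  exact: (is_deriveD (du _) (is_deriveD (is_deriveD (is_deriveB (dm 0 2) (dm 1 3)) (dm 2 0)) (dm 3 1)))%N.
- under eq_fun do rewrite qcoordD qcoordM3; rewrite qcoordD qcoordM3.
  exact: (is_deriveD (du _) (is_deriveD (is_deriveB (is_deriveD (dm 0 3) (dm 1 2)) (dm 2 1)) (dm 3 0)))%N.
Qed.

End QuatDiff.

(** * Injective slice regular functions *)

Section Injective.
Variable R : realType.
Local Notation C := (R * R)%type.
Local Notation H := (quat R).
Local Notation HC := (quat R * quat R)%type.
(* dF will be d_alpha F: it is kept abstract because unification would otherwise
   unfold directional derivatives. *)
Variables (D : set C) (F dF : C -> HC) (f : H -> H).
Hypothesis oD : open D.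
Hypothesis stemF : stem_function D F.
Hypothesis fF : induced_by D F f.
Hypothesis holF : forall k z, D z ->
  hol (fun z => Ccoord (F z) k) (fun z => Ccoord (dF z) k) z.
Hypothesis f_inj : {in circularization D &, injective f}.
Implicit Types (z : C) (J : H) (p : C * H).

(** A point x = alpha + J beta is handled as the pair p = (z, J) with J ranging over all of [H];
    being a unit is a separate hypothesis. Neighborhoods are then those of a product space, and z
    and J can be moved independently. *)
Definition fval p : H := (F p.1).1 + p.2 * (F p.1).2.
Definition vec p z : HC := ((F z).1 - fval p, (F z).2).
(* This is N_c, where c is the value of f at slice_point p.1 p.2, and
   dnorm_form p is its complex derivative. *)
Definition norm_form p z : C := cform (vec p z) (vec p z).
Definition dnorm_form p z : C := cform (vec p z) (dF z) + cform (vec p z) (dF z).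

Lemma fval_inj p q : D p.1 -> D q.1 -> imaginary_units p.2 -> imaginary_units q.2 ->
  fval p = fval q -> slice_point p.1 p.2 = slice_point q.1 q.2.
Proof.
move=> Dp Dq Up Uq E; apply: f_inj.
- by apply/mem_set; exists p.1, p.2.
- by apply/mem_set; exists q.1, q.2.
- by rewrite !fF.
Qed.

(** A zero of the form provides, through [null_vector], a unit J such that f takes at
    [slice_point z J] its value at p; by injectivity the two points coincide. *)
Lemma norm_form_eq0 p z : D p.1 -> imaginary_units p.2 -> D z -> norm_form p z = 0 ->
  z = p.1 \/ z = conjC p.1.
Proof.
move=> Dp Up Dz /null_vector[J UJ] /= E.
apply: (@slice_point_eq _ z p.1 J p.2) => //.
apply: (@fval_inj (z, J) p) => //.
by apply/eqP; rewrite -subr_eq0 {1}/fval /= addrAC E.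
Qed.

Lemma qcvg_F z : D z -> [/\ qcvg (nbhs z) (fun z => (F z).1) (F z).1,
  qcvg (nbhs z) (fun z => (F z).2) (F z).2,
  qcvg (nbhs z) (fun z => (dF z).1) (dF z).1 &
  qcvg (nbhs z) (fun z => (dF z).2) (dF z).2].
Proof.
move=> Dz; split=> k k4; have [/cdiff_continuous/cvgC[c1 c2] /cvgC[d1 d2]] := holF k Dz.
- exact: c1.
- exact: c2.
- exact: d1.
- exact: d2.
Qed.

Lemma qcvg_fval (T : Type) (G : set_system T) {FG : Filter G} (u : T -> C * H) p :
  D p.1 -> u @ G --> p -> qcvg G (fun x => fval (u x)) (fval p).
Proof.
case: p => z J /= Dz up.
have u1 : (u x).1 @[x --> G] --> z.
  exact: (cvg_comp u fst up (@cvg_fst _ _ (nbhs z) (nbhs J) _)).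
have u2 : (u x).2 @[x --> G] --> J.
  exact: (cvg_comp u snd up (@cvg_snd _ _ (nbhs z) (nbhs J) _)).
have [F1 F2 _ _] := qcvg_F Dz.
apply: qcvgD => [k k4|].
  exact: (cvg_comp (fun x => (u x).1) (fun z => qcoord (F z).1 k) u1 (F1 k k4)).
apply: qcvgM => k k4.
  have h := @continuous_qcoord R k J.
  exact: (cvg_comp (fun x => (u x).2) (fun q : H => qcoord q k) u2 h).
exact: (cvg_comp (fun x => (u x).1) (fun z => qcoord (F z).2 k) u1 (F2 k k4)).
Qed.

Lemma cvg_norm_form (T : Type) (G : set_system T) {FG : Filter G} (u : T -> C * H) (v : T -> C) p z :
  D p.1 -> D z -> u @ G --> p -> v @ G --> z ->
  norm_form (u x) (v x) @[x --> G] --> norm_form p z.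
Proof.
move=> Dp Dz up vz; have [F1 F2 _ _] := qcvg_F Dz; have fp := @qcvg_fval T G FG u p Dp up.
have v1 : qcvg G (fun x => (vec (u x) (v x)).1) (vec p z).1.
  apply: qcvgD; last exact: (qcvgN fp).
  by move=> k k4; exact: (cvg_comp v (fun z => qcoord (F z).1 k) vz (F1 k k4)).
have v2 : qcvg G (fun x => (vec (u x) (v x)).2) (vec p z).2.
  by move=> k k4; exact: (cvg_comp v (fun z => qcoord (F z).2 k) vz (F2 k k4)).
exact: cvg_cform.
Qed.

Lemma cvg_dnorm_form (T : Type) (G : set_system T) {FG : Filter G} (u : T -> C * H) (v : T -> C) p z :
  D p.1 -> D z -> u @ G --> p -> v @ G --> z ->
  dnorm_form (u x) (v x) @[x --> G] --> dnorm_form p z.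
Proof.
move=> Dp Dz up vz; have [F1 F2 dF1 dF2] := qcvg_F Dz; have fp := @qcvg_fval T G FG u p Dp up.
have v1 : qcvg G (fun x => (vec (u x) (v x)).1) (vec p z).1.
  apply: qcvgD; last exact: (qcvgN fp).
  by move=> k k4; exact: (cvg_comp v (fun z => qcoord (F z).1 k) vz (F1 k k4)).
have v2 : qcvg G (fun x => (vec (u x) (v x)).2) (vec p z).2.
  by move=> k k4; exact: (cvg_comp v (fun z => qcoord (F z).2 k) vz (F2 k k4)).
have w1 : qcvg G (fun x => (dF (v x)).1) (dF z).1.
  by move=> k k4; exact: (cvg_comp v (fun z => qcoord (dF z).1 k) vz (dF1 k k4)).
have w2 : qcvg G (fun x => (dF (v x)).2) (dF z).2.
  by move=> k k4; exact: (cvg_comp v (fun z => qcoord (dF z).2 k) vz (dF2 k k4)).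
by apply: cvg_cadd; exact: cvg_cform.
Qed.

Lemma hol_vec p k z : D z ->
  hol (fun z => Ccoord (vec p z) k) (fun z => Ccoord (dF z) k) z.
Proof.
move=> Dz; have := holD (holF k Dz) (hol_cst (- qcoord (fval p) k, 0) z).
have -> : (fun x => Ccoord (F x) k + (- qcoord (fval p) k, 0)) =
    (fun z => Ccoord (vec p z) k).
  apply/funext => x; apply/pair_equal_spec; split => /=; last by rewrite addr0.
  by rewrite qcoordD qcoordN.
by have -> : (fun x => Ccoord (dF x) k + 0) = (fun z => Ccoord (dF z) k)
  by apply/funext => x; rewrite addr0.
Qed.

Lemma hol_norm_form p z : D z -> hol (norm_form p) (dnorm_form p) z.
Proof.
move=> Dz; pose sq k := holM (hol_vec p k Dz) (hol_vec p k Dz).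
have := holD (holD (holD (sq 0%N) (sq 1%N)) (sq 2%N)) (sq 3%N).
set d := (X in hol _ X); have -> // : d = dnorm_form p.
apply/funext => x; rewrite /d /dnorm_form /cform.
move: (Ccoord (dF x)) (Ccoord (vec p x)) => a b.
by apply/pair_equal_spec; split; rewrite /cmul /=; ring.
Qed.

Lemma near_circle_D z : D z -> exists2 r, 0 < r & forall z', ball z r z' -> D z'.
Proof. by move=> Dz; have /nbhs_ballP[r r0 h] := open_nbhs_nbhs (conj oD Dz); exists r. Qed.

(** The form has no zero on the circle around p.1, so its squared modulus has a positive minimum
    there. Half of this minimum remains a bound for all q near p, by joint continuity and
    compactness of the angle segment; the circle moves with q while its radius stays fixed. *)
Lemma circle_bound (p : C * H) (r : R) : D p.1 -> imaginary_units p.2 -> 0 < r ->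
  (forall t, D (circle p.1 r t) /\ circle p.1 r t <> conjC p.1) ->
  exists2 m, 0 < m & \forall q \near p, forall t, 0 <= t <= pi *+ 2 ->
    m <= normC2 (norm_form q (circle q.1 r t)).
Proof.
move=> Dp Up r0 Hc.
pose g t := normC2 (norm_form p (circle p.1 r t)).
have cc (q0 : C * H) t : (fun x : R * (C * H) => circle x.2.1 r x.1) @ (t, q0) --> circle q0.1 r t.
  have c1 : (fun x : R * (C * H) => x.1) @ (t, q0) --> t
    by exact: (@cvg_fst _ _ (nbhs t) (nbhs q0) _).
  have c2 : (fun x : R * (C * H) => x.2) @ (t, q0) --> q0
    by exact: (@cvg_snd _ _ (nbhs t) (nbhs q0) _).
  have c21 : (fun x : R * (C * H) => x.2.1) @ (t, q0) --> q0.1.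
    case: q0 c1 c2 => z0 J0 c1 c2.
    exact: (cvg_comp _ fst c2 (@cvg_fst _ _ (nbhs z0) (nbhs J0) _)).
  have [c211 c212] := (cvgC _ _).1 c21.
  apply/cvgC; split => /=; apply: cvgD => //; apply: cvgM; try exact: cvg_cst.
    by apply: (cvg_comp _ cos c1); exact: continuous_cos.
  by apply: (cvg_comp _ sin c1); exact: continuous_sin.
have cN t : (fun x : R * (C * H) => normC2 (norm_form x.2 (circle x.2.1 r x.1))) @ (t, p) --> g t.
  apply: cvg_normC2; apply: cvg_norm_form => //; first exact: (Hc t).1.
    exact: (@cvg_snd _ _ (nbhs t) (nbhs p) _).
  exact: cc.
have cg : continuous g.
  move=> t; have ct : (fun s : R => (s, p)) @ t --> (t, p).
    apply: (@cvg_pair _ _ _ (nbhs t) (nbhs t) (nbhs p)) => //; exact: cvg_cst.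
  exact: (cvg_comp _ _ ct (cN t)).
have gpos t : 0 < g t.
  rewrite lt_def normC2_ge0 andbT normC2_eq0; apply/eqP => N0.
  have [e|] := norm_form_eq0 Dp Up (Hc t).1 N0; last by case: (Hc t).
  by have := circle_neq p.1 t r0; rewrite e eqxx.
have pi20 : (0 : R) <= pi *+ 2 by rewrite mulrn_wge0 // pi_ge0.
have [c _ cmin] := EVT_min pi20 (continuous_subspaceT cg).
have gc2 : 0 < g c / 2 by rewrite divr_gt0.
exists (g c / 2) => //.
have near_t t : `[0, pi *+ 2]%classic t -> \forall t' \near t & q \near nbhs p,
    g c / 2 <= normC2 (norm_form q (circle q.1 r t')).
  move=> tin; have glt : g c / 2 < g t.
    by apply: lt_le_trans (cmin t tin); rewrite ltr_pdivrMr // ltr_pMr // ltr1n.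
  have h : \forall x \near (t, p), g c / 2 < normC2 (norm_form x.2 (circle x.2.1 r x.1)).
    by apply: (cvgr_gt (g t) (cN t)).
  by apply: filterS h => -[s q] /= /ltW.
have h := (compact_near_coveringP _).1 (@segment_compact R 0 (pi *+ 2)) (C * H)%type (nbhs p)
  (fun q t => g c / 2 <= normC2 (norm_form q (circle q.1 r t))) (nbhs_filter p) near_t.
by apply: filterS h => q hq t ht; apply: hq; rewrite /= in_itv.
Qed.

(** If F' vanishes on a horizontal segment, then F is constant on it and f takes one value at two
    points with different real parts. Only the horizontal line matters, so the lemma serves both for
    full neighborhoods and for intervals of the real axis. *)
Lemma dF_not_locally_zero z : D z ->
  ~ (\forall z' \near z, z'.2 = z.2 -> dF z' = 0).
Proof.
move=> Dz near0.
have /nbhs_ballP[r /= r0 hr] : \forall z' \near z, D z' /\ (z'.2 = z.2 -> dF z' = 0).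
  by apply: filterI near0; exact: open_nbhs_nbhs.
have r2 : `|r / 2| < r by rewrite gtr0_norm ?divr_gt0 //; lra.
have h x : `|x - z.1| <= `|r / 2| -> D (x, z.2) /\ dF (x, z.2) = 0.
  move=> xz; have [|Dx dx] := hr (x, z.2); last by split=> //; apply: dx.
  split; rewrite /ball /=; last by rewrite subrr normr0.
  by rewrite distrC (le_lt_trans xz).
have dx (x : R) : is_derive x 1 (fun x => (x, z.2)) ((1, 0) : C).
  exact: is_derive_pair.
have E : F (r / 2 + z.1, z.2) = F z.
  rewrite [RHS]surjective_pairing [LHS]surjective_pairing; congr (_, _).
    apply: quatP => k k4; apply/eqP; rewrite -subr_eq0.
    have [|c _] := @MVT_abs _ (fun x => qcoord (F (x, z.2)).1 k) (fun=> 0) z.1 (r / 2).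
      move=> x /h[Dx dx0]; have [[h1 _] _] := holF k Dx.
      apply: is_derive_eq; first exact: (is_derive_curve (g := fun x => (x, z.2)) h1 (dx x)).
      by rewrite dx0 /cmul /Ccoord /= !qcoord0 !mul0r subrr.
    by rewrite mul0r -surjective_pairing => ->.
  apply: quatP => k k4; apply/eqP; rewrite -subr_eq0.
  have [|c _] := @MVT_abs _ (fun x => qcoord (F (x, z.2)).2 k) (fun=> 0) z.1 (r / 2).
    move=> x /h[Dx dx0]; have [[_ h1] _] := holF k Dx.
    apply: is_derive_eq; first exact: (is_derive_curve (g := fun x => (x, z.2)) h1 (dx x)).
    by rewrite dx0 /cmul /Ccoord /= !qcoord0 !mul0r addr0.
  by rewrite mul0r -surjective_pairing => ->.
pose J : H := mkquat 0 1 0 0.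
have UJ : imaginary_units J.
  by apply/imaginary_unitP; rewrite /qdot !qcoordE //=; split=> //; ring.
have [|Dh _] := h (r / 2 + z.1); first by rewrite addrK.
have Eval : fval (r / 2 + z.1, z.2, J) = fval (z, J) by rewrite /fval /= E.
have Es := fval_inj (p := (r / 2 + z.1, z.2, J)) (q := (z, J)) Dh Dz UJ UJ Eval.
have r20 : 0 < r / 2 by rewrite divr_gt0.
by case: (slice_point_eq UJ UJ Es) => /(congr1 fst) /= /eqP;
  rewrite -subr_eq0 addrK gt_eqF.
Qed.

(** Here q is (z - p.1)^{-1} off the real axis and (z - p.1)^{-2} on it, and kappa is its squared
    modulus on the circle of radius r. The product of the form with q has no zero in the punctured
    disc, so [center_min] gives |d|^2 >= m kappa as soon as d <> 0. *)
Lemma center_dichotomy p (q dq : C -> C) (d : C) (r m kappa : R) :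
  D p.1 -> imaginary_units p.2 -> 0 < r -> 0 < m -> 0 < kappa ->
  (forall s t, 0 < s <= r -> D (circle p.1 s t) /\ circle p.1 s t <> conjC p.1) ->
  (forall z, z != p.1 -> hol q dq z /\ q z != 0) ->
  (forall t, normC2 (q (circle p.1 r t)) = kappa) ->
  cmul (norm_form p z) (q z) @[z --> p.1^'] --> d ->
  (forall t, 0 <= t <= pi *+ 2 -> m <= normC2 (norm_form p (circle p.1 r t))) ->
  normC2 d < m * kappa -> d = 0.
Proof.
move=> Dp Up r0 m0 k0 Hc Hq qk lim Hm dlt.
apply/eqP/negPn/negP => d0; move: dlt; apply/negP; rewrite -leNgt.
refine (@center_min _ (fun z => cmul (norm_form p z) (q z))
  (fun z => cmul (norm_form p z) (dq z) + cmul (dnorm_form p z) (q z)) p.1 d r _ r0 _ _ lim d0 _).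
- by rewrite mulr_gt0.
- move=> s t sr; have [Dz zc] := Hc s t sr.
  have zp : circle p.1 s t != p.1 by apply: circle_neq; case/andP: sr.
  have [hq q0] := Hq _ zp; split; first exact: holM (hol_norm_form p Dz) hq.
  rewrite -normC2_eq0 normC2M mulf_neq0 // normC2_eq0 //.
  apply/eqP => N0; have [e|//] := norm_form_eq0 Dp Up Dz N0.
  by rewrite e eqxx in zp.
- by move=> t ht; rewrite normC2M qk ler_pM2r // Hm.
Qed.

Lemma normC2_circle (c : C) r t : normC2 (circle c r t - c) = r ^+ 2.
Proof.
have -> : circle c r t - c = (r * cos t, r * sin t).
  by apply/pair_equal_spec; split; rewrite /= addrAC subrr add0r.
by rewrite /normC2 /= !exprMn -mulrDr cos2Dsin2 mulr1.
Qed.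

Lemma vec_self p : vec p p.1 = (- (p.2 * (F p.1).2), (F p.1).2).
Proof. by rewrite /vec /fval opprD addrA subrr sub0r. Qed.

Lemma norm_form_self p : imaginary_units p.2 -> norm_form p p.1 = 0.
Proof.
move=> /imaginary_unitP[J0 J1]; rewrite /norm_form vec_self cformE.
move: (F p.1).2 => s; apply/pair_equal_spec; split => /=.
  have -> : qdot (- (p.2 * s)) (- (p.2 * s)) = qdot p.2 p.2 * qdot s s.
    by rewrite /qdot !qcoordE; ring.
  by rewrite J1 mul1r subrr.
by rewrite /qdot !qcoordE J0; ring.
Qed.

Lemma hol_cinv_sub (c z : C) : z != c -> hol (fun z => cinv (z - c))
  (fun z => - cmul (cmul (cinv (z - c)) (cinv (z - c))) ((1, 0) + 0)) z.
Proof.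
rewrite -subr_eq0 => zc; exact: holV (holD (hol_id z) (hol_cst (- c) z)) zc.
Qed.

Lemma cinv_neq0 (z : C) : z != 0 -> cinv z != 0.
Proof. by rewrite -!normC2_eq0 normC2V invr_eq0. Qed.

(** Otherwise f would be constant on the sphere of z, for instance equal at the units i and -i. *)
Lemma F2_neq0 z : D z -> z.2 != 0 -> (F z).2 != 0.
Proof.
move=> Dz z0; apply/negP => /eqP F0.
have [U UN] : imaginary_units (mkquat 0 1 0 0 : H) /\ imaginary_units (mkquat 0 (-1) 0 0 : H).
  by split; apply/imaginary_unitP; rewrite /qdot !qcoordE //=; split=> //; ring.
have := fval_inj (p := (z, mkquat 0 1 0 0)) (q := (z, mkquat 0 (-1) 0 0)) Dz Dz U UN.
rewrite /fval /= F0 !mulr0 => /(_ erefl)/(congr1 (fun q => qcoord q 1)).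
rewrite /slice_point !qcoordE //= mulr1 mulrN1 => /eqP.
by rewrite -subr_eq0; move/eqP => e; move: z0; rewrite (_ : z.2 = 0) ?eqxx //; lra.
Qed.

Lemma near_pair (T1 T2 : topologicalType) (P : T1 * T2 -> Prop) (p : T1 * T2) :
  (\forall q \near p, P q) -> \forall x \near p.1, \forall y \near p.2, P (x, y).
Proof.
move=> [[A B] /= [Ap Bp] AB]; apply: filterS Ap => x Ax; apply: filterS Bp => y By.
exact: AB.
Qed.

Lemma ball_ball_circle (c c' : C) (rho s t : R) : ball c (rho / 2) c' ->
  0 < s <= rho / 4 -> ball c rho (circle c' s t).
Proof.
move=> cc /andP[s0 sr]; apply: (ball_split cc); apply: ball_circle.
by rewrite s0 /=; lra.
Qed.

(** If the derivative vanishes at p, it is small near p, hence zero near p by [center_dichotomy].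
    Fixing z and letting J vary then gives F'(z) = 0 for every z near p.1. *)
Lemma dnorm_form_neq0 p : D p.1 -> 0 < p.1.2 -> imaginary_units p.2 -> dnorm_form p p.1 != 0.
Proof.
move=> Dp p0 Up; apply/negP => /eqP dN0.
have [rho0 rho00 Hrho0] := near_circle_D Dp.
(* Keeps the disc in the upper half-plane, away from the conjugates of its points. *)
pose rho := Num.min rho0 p.1.2.
have rhopos : 0 < rho by rewrite lt_min rho00.
have Hrho z : ball p.1 rho z -> D z /\ 0 < z.2.
  move=> hz; split; first by apply: Hrho0; apply: le_ball hz; rewrite ge_min lexx.
  case: hz => _; rewrite /ball /= => /(le_lt_trans (ler_norm _)) hz.
  have : rho <= p.1.2 by rewrite ge_min lexx orbT.
  by lra.
pose r := rho / 4.
have r0 : 0 < r by rewrite divr_gt0.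
have Hcirc (q : C * H) s t : ball p.1 (rho / 2) q.1 -> 0 < s <= r ->
    D (circle q.1 s t) /\ circle q.1 s t <> conjC q.1.
  move=> hq hs; have [Dc c0] := Hrho _ (ball_ball_circle t hq hs); split=> // e.
  have [_ q0] : D q.1 /\ 0 < q.1.2.
    by apply: Hrho; apply: le_ball hq; lra.
  by move: c0; rewrite e /conjC /=; lra.
have [|m m0 Hm] := @circle_bound p r Dp Up r0.
  by move=> t; apply: Hcirc; [apply: ballxx; rewrite divr_gt0|rewrite r0 lexx].
have k0 : 0 < (r ^+ 2)^-1 by rewrite invr_gt0 exprn_gt0.
have fstp : (fun q : C * H => q.1) @ p --> p.1.
  by case: (p) => a b; exact: (@cvg_fst _ _ (nbhs a) (nbhs b) _).
have near_small : \forall q \near p, normC2 (dnorm_form q q.1) < m * (r ^+ 2)^-1.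
  have lim : normC2 (dnorm_form q q.1) @[q --> p] --> normC2 (dnorm_form p p.1).
    by apply: cvg_normC2; apply: cvg_dnorm_form => //; exact: cvg_id.
  apply: (cvgr_lt (normC2 (dnorm_form p p.1)) lim).
  by rewrite dN0 /normC2 /= expr0n addr0 mulr_gt0.
have near_ball : \forall q \near p, ball p.1 (rho / 2) q.1.
  by apply: fstp; apply: nbhsx_ballx; rewrite divr_gt0.
have near0 : \forall q \near p, imaginary_units q.2 -> dnorm_form q q.1 = 0.
  apply: filterS3 Hm near_small near_ball => q hm hs hb Uq.
  have [Dq _] : D q.1 /\ 0 < q.1.2 by apply: Hrho; apply: le_ball hb; lra.
  refine (@center_dichotomy q (fun z => cinv (z - q.1)) _ (dnorm_form q q.1) r m (r ^+ 2)^-1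
    Dq Uq r0 m0 k0 _ _ _ _ hm hs).
  - by move=> s t hst; apply: Hcirc.
  - move=> z zq; split; first exact: hol_cinv_sub.
    by apply: cinv_neq0; rewrite subr_eq0.
  - by move=> t; rewrite normC2V normC2_circle.
  - by apply: cdiff_quotient; [exact: (hol_norm_form q Dq).1|exact: norm_form_self].
apply: (dF_not_locally_zero Dp).
have near_D : \forall z \near p.1, ball p.1 rho z by exact: nbhsx_ballx.
apply: filterS2 near_D (near_pair near0) => z /Hrho[Dz z0] hz _.
apply: (cform_locally_zero Up (F2_neq0 Dz _)); first by rewrite gt_eqF.
apply: filterS hz => J h UJ; have := h UJ.
rewrite /dnorm_form (vec_self (z, J)) /=; set c := cform _ _.
case: c => c1 c2 /pair_equal_spec[/= e1 e2]; apply/pair_equal_spec; split => /=; lra.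
Qed.

Lemma F2_real z : D z -> z.2 = 0 -> (F z).2 = 0.
Proof.
move=> Dz z0; have [_] := stemF Dz.
rewrite (_ : conjC z = z); last by case: z z0 {Dz} => a b /= ->; rewrite /conjC /= oppr0.
move=> /eqP; rewrite -addr_eq0 -mulr2n -scaler_nat scaler_eq0 pnatr_eq0 /=.
by move=> /eqP.
Qed.

(** F_2 is zero along the real axis, and F' is the derivative in the direction of that axis. *)
Lemma dF2_real z : D z -> z.2 = 0 -> (dF z).2 = 0.
Proof.
move=> Dz z0; apply: quatP => k k4; rewrite qcoord0.
have [[_ h2] _] := holF k Dz.
have dx : is_derive z.1 1 (fun x => (x, z.2)) ((1, 0) : C) by exact: is_derive_pair.
rewrite [z in is_diff z]surjective_pairing in h2.
have [_ E] := is_derive_curve (g := fun x => (x, z.2)) h2 dx.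
have -> : qcoord (dF z).2 k = (cmul (Ccoord (dF z) k) (1, 0)).2.
  by rewrite /cmul /Ccoord /= mulr0 add0r mulr1.
rewrite -E -[RHS](@derive_cst _ R R (0 : R) z.1 1).
apply: near_eq_derive.
have [r r0 hr] := near_circle_D Dz.
apply/nbhs_ballP; exists r => // x hx /=.
rewrite F2_real ?qcoord0 //; apply: hr; split => //=.
by rewrite /ball /= subrr normr0.
Qed.

(** Same scheme as [dnorm_form_neq0], with x moving along the real axis only. The unit [J] is an
    arbitrary choice, since a real point lies in every slice. *)
Lemma dF1_real_neq0 z : D z -> z.2 = 0 -> (dF z).1 != 0.
Proof.
move=> Dz z0; apply/negP => /eqP dF0.
have [rho rho0 Hrho] := near_circle_D Dz.
pose J : H := mkquat 0 1 0 0.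
have UJ : imaginary_units J.
  by apply/imaginary_unitP; rewrite /qdot !qcoordE //=; split=> //; ring.
pose r := rho / 4.
have r0 : 0 < r by rewrite divr_gt0.
have conj_real (x : C) : x.2 = 0 -> conjC x = x.
  by case: x => a b /= ->; rewrite /conjC /= oppr0.
have Hcirc (x : C) s t : ball z (rho / 2) x -> x.2 = 0 -> 0 < s <= r ->
    D (circle x s t) /\ circle x s t <> conjC x.
  move=> hx x0 hs; split; first exact: (Hrho _ (ball_ball_circle t hx hs)).
  by rewrite conj_real //; apply/eqP; apply: circle_neq; case/andP: hs.
have [|m m0 Hm] := @circle_bound (z, J) r Dz UJ r0.
  by move=> t; apply: Hcirc => //; [apply: ballxx; rewrite divr_gt0|rewrite r0 lexx].
(* The squared modulus r^{-4} of (y - x)^{-2} on the circle of radius r. *)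
pose kappa := (r ^+ 2)^-1 * (r ^+ 2)^-1.
have k0 : 0 < kappa by rewrite mulr_gt0 // invr_gt0 exprn_gt0.
have near_m : \forall x \near z, forall t, 0 <= t <= pi *+ 2 ->
    m <= normC2 (norm_form (x, J) (circle x r t)).
  by apply: filterS (near_pair Hm) => x hx; exact: nbhs_singleton hx.
have near_small : \forall x \near z, normC2 (cform (dF x) (dF x)) < m * kappa.
  have [_ _ c1 c2] := qcvg_F Dz.
  have lim : normC2 (cform (dF x) (dF x)) @[x --> z] --> normC2 (cform (dF z) (dF z)).
    by apply: cvg_normC2; apply: cvg_cform.
  apply: (cvgr_lt (normC2 (cform (dF z) (dF z))) lim).
  rewrite cformE dF0 dF2_real // /qdot !qcoord0 /normC2 /= !mul0r !addr0 subr0 expr0n addr0.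
  by rewrite mulr_gt0.
have near_ball : \forall x \near z, ball z (rho / 2) x.
  by apply: nbhsx_ballx; rewrite divr_gt0.
apply: (dF_not_locally_zero Dz).
apply: filterS3 near_m near_small near_ball => x hm hs hb; rewrite z0 => x0.
have Dx : D x by apply: Hrho; apply: le_ball hb; lra.
(* Since F_2(x) = 0, each complex coordinate of F - f(x) vanishes at x. The form divided by (y -
   x)^2 is thus a sum of four squared difference quotients, with limit [cform (dF x) (dF x)]. *)
have lim_k k : cmul (Ccoord (vec (x, J) y) k) (cinv (y - x)) @[y --> x^'] --> Ccoord (dF x) k.
  apply: cdiff_quotient; first exact: (hol_vec (x, J) k Dx).1.
  by rewrite (vec_self (x, J)) /= F2_real // mulr0 oppr0 /Ccoord /= qcoord0.
have form0 : cform (dF x) (dF x) = 0.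
  refine (@center_dichotomy (x, J) (fun y => cmul (cinv (y - x)) (cinv (y - x))) _
    (cform (dF x) (dF x)) r m kappa Dx UJ r0 m0 k0 _ _ _ _ hm hs).
  - by move=> s t hst; apply: Hcirc.
  - move=> y yx; split; first exact: holM (hol_cinv_sub yx) (hol_cinv_sub yx).
    rewrite -normC2_eq0 normC2M mulf_neq0 // normC2_eq0 cinv_neq0 // subr_eq0 //.
  - by move=> t; rewrite normC2M !normC2V normC2_circle.
  - have -> : (fun y => cmul (norm_form (x, J) y) (cmul (cinv (y - x)) (cinv (y - x)))) =
      (fun y => let a k := cmul (Ccoord (vec (x, J) y) k) (cinv (y - x)) in
        cmul (a 0%N) (a 0%N) + cmul (a 1%N) (a 1%N) + cmul (a 2%N) (a 2%N) + cmul (a 3%N) (a 3%N)).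
      apply/funext => y; rewrite /norm_form /cform /=; move: (cinv (y - x)) (Ccoord (vec (x, J) y)) => i a.
      by apply/pair_equal_spec; split; rewrite /cmul /=; ring.
    have l k := @cvg_cmul _ _ _ (dnbhs_filter x) _ _ _ _ (lim_k k) (lim_k k).
    exact: (cvg_cadd (cvg_cadd (cvg_cadd (l 0%N) (l 1%N)) (l 2%N)) (l 3%N)).
move: form0; rewrite cformE dF2_real // => -[+ _].
rewrite [qdot 0 0]/qdot !qcoord0 !mul0r !addr0 subr0 => /eqP; rewrite qdot_eq0 => /eqP a0.
by rewrite [LHS]surjective_pairing a0 dF2_real.
Qed.

(** * Invertibility of the differential off the real axis *)

Definition imnorm (x : H) : R :=
  Num.sqrt (qcoord x 1 * qcoord x 1 + qcoord x 2 * qcoord x 2 + qcoord x 3 * qcoord x 3).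

(** The representative of the sphere of x in the closed upper half-plane; it depends differentiably
    on x off the real axis. *)
Definition halfplane (x : H) : C := (qcoord x 0, imnorm x).

Definition impart (x : H) : H := mkquat 0 (qcoord x 1) (qcoord x 2) (qcoord x 3).

Lemma imnorm_sqr (x : H) : imnorm x ^+ 2 = qdot (impart x) (impart x).
Proof.
rewrite sqr_sqrtr ?addr_ge0 // -?expr2 ?sqr_ge0 //.
by rewrite /qdot !qcoordE //= mulr0 add0r.
Qed.

Lemma polar_form (x : H) : 0 < imnorm x ->
  imaginary_units ((imnorm x)^-1 *: impart x) /\
  x = slice_point (halfplane x) ((imnorm x)^-1 *: impart x).
Proof.
move=> n0; have n1 : imnorm x != 0 by rewrite gt_eqF.
split.
  apply/imaginary_unitP; split; first by rewrite !qcoordE //= mulr0.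
  by rewrite qdotZ qdotC qdotZ -imnorm_sqr mulrA -expr2 -exprMn mulVf // expr1n.
rewrite /slice_point scalerA divff // scale1r /=.
by apply: quatP => -[|[|[|[|//]]]] _; rewrite !qcoordE //=; ring.
Qed.

Lemma polar_form_ex (x : H) : exists2 J, imaginary_units J & x = slice_point (halfplane x) J.
Proof.
have := sqrtr_ge0 (qcoord x 1 * qcoord x 1 + qcoord x 2 * qcoord x 2 + qcoord x 3 * qcoord x 3).
rewrite -/(imnorm x) le_eqVlt => /orP[/eqP n0|/polar_form[UJ xE]]; last first.
  by exists ((imnorm x)^-1 *: impart x).
exists (mkquat 0 1 0 0).
  by apply/imaginary_unitP; rewrite /qdot !qcoordE //=; split=> //; ring.
have /eqP := imnorm_sqr x; rewrite -n0 expr0n /= eq_sym qdot_eq0 => /eqP i0.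
rewrite /slice_point /= -n0 scale0r addr0.
have -> : x = (qcoord x 0)%:A + impart x.
  by apply: quatP => -[|[|[|[|//]]]] _; rewrite !qcoordE //=; ring.
by rewrite i0 addr0 !qcoordE //= mulr1.
Qed.

Lemma halfplane_slice z J : imaginary_units J -> 0 <= z.2 ->
  halfplane (slice_point z J) = z.
Proof.
move=> /imaginary_unitP[J0 J1] z0; rewrite [RHS]surjective_pairing; congr (_, _).
  by rewrite /slice_point !qcoordE //= J0; ring.
have -> : imnorm (slice_point z J) = Num.sqrt (z.2 ^+ 2 * qdot J J).
  by congr Num.sqrt; rewrite /slice_point /qdot J0 !qcoordE //=; ring.
by rewrite J1 mulr1 sqrtr_sqr ger0_norm.
Qed.

Lemma differentiable_imnorm (x : H) : 0 < imnorm x -> differentiable imnorm x.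
Proof.
move=> n0; pose s (y : H) := qcoord y 1 * qcoord y 1 + qcoord y 2 * qcoord y 2 + qcoord y 3 * qcoord y 3.
have s0 : 0 < s x by rewrite -sqrtr_gt0.
have d k : differentiable ((fun y : H => qcoord y k) * (fun y : H => qcoord y k)) x.
  by apply: differentiableM; exact: differentiable_qcoord.
have ds : differentiable s x := differentiableD (differentiableD (d 1%N) (d 2%N)) (d 3%N).
apply: (@differentiable_comp _ _ _ _ s Num.sqrt) => //.
by apply/derivable1_diffP; have [] := is_derive1_sqrt s0.
Qed.

Lemma differentiable_halfplane (x : H) : 0 < imnorm x -> differentiable halfplane x.
Proof.
move=> n0; apply: differentiable_pair; first exact: differentiable_qcoord.
exact: differentiable_imnorm.
Qed.

(** Near a nonreal point both z and J are differentiable functions of y, namely [halfplane y] and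
    the normalized imaginary part, so f is given by an explicit formula. *)
Lemma differentiable_nonreal p : D p.1 -> 0 < p.1.2 -> imaginary_units p.2 ->
  differentiable f (slice_point p.1 p.2).
Proof.
move=> Dp p0 Up; set x := slice_point p.1 p.2.
have hx : halfplane x = p.1 by apply: halfplane_slice => //; exact: ltW.
have nx : 0 < imnorm x by rewrite -[imnorm x]/(halfplane x).2 hx.
have dh := differentiable_halfplane nx.
have near_f : \forall y \near x, f y = (F (halfplane y)).1 +
    ((imnorm y)^-1 *: impart y) * (F (halfplane y)).2.
  have near_D : \forall y \near x, D (halfplane y).
    have := differentiable_continuous dh.
    by apply; rewrite hx; exact: open_nbhs_nbhs.
  have near_n : \forall y \near x, 0 < imnorm y.
    exact: (cvgr_gt (imnorm x) (differentiable_continuous (differentiable_imnorm nx))).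
  apply: filterS2 near_D near_n => y Dy /polar_form[UJ yE].
  by rewrite [in LHS]yE fF.
apply: (near_eq_differentiable near_f).
have dF1 k : differentiable (fun y => qcoord (F (halfplane y)).1 k) x.
  apply: (@differentiable_comp _ _ _ _ halfplane (fun z => qcoord (F z).1 k)) => //.
  by rewrite hx; have [[[]]] := holF k Dp.
have dF2 k : differentiable (fun y => qcoord (F (halfplane y)).2 k) x.
  apply: (@differentiable_comp _ _ _ _ halfplane (fun z => qcoord (F z).2 k)) => //.
  by rewrite hx; have [[_ []]] := holF k Dp.
have dJ k : (k < 4)%N -> differentiable (fun y => qcoord ((imnorm y)^-1 *: impart y) k) x.
  move=> k4; have -> : (fun y => qcoord ((imnorm y)^-1 *: impart y) k) =
      (fun y => (imnorm y)^-1) * (fun y => [:: 0; qcoord y 1; qcoord y 2; qcoord y 3]`_k).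
    by apply/funext => y; rewrite qcoordZ qcoord_mk.
  apply: differentiableM.
    by apply: differentiableV; [exact: differentiable_imnorm|rewrite gt_eqF].
  by case: k k4 => [|[|[|[|//]]]] _ /=; [exact: differentiable_cst|..];
    exact: differentiable_qcoord.
have dm i j : (i < 4)%N -> differentiable ((fun y => qcoord ((imnorm y)^-1 *: impart y) i) *
    (fun y => qcoord (F (halfplane y)).2 j)) x.
  by move=> i4; apply: differentiableM; [exact: dJ|exact: dF2].
apply: quat_differentiable => -[|[|[|[|//]]]] _.
- under eq_fun do rewrite qcoordD qcoordM0.
  exact: (differentiableD (dF1 _) (differentiableB (differentiableB (differentiableB
    (dm 0 0 isT) (dm 1 1 isT)) (dm 2 2 isT)) (dm 3 3 isT)))%N.
- under eq_fun do rewrite qcoordD qcoordM1.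
  exact: (differentiableD (dF1 _) (differentiableB (differentiableD (differentiableD
    (dm 0 1 isT) (dm 1 0 isT)) (dm 2 3 isT)) (dm 3 2 isT)))%N.
- under eq_fun do rewrite qcoordD qcoordM2.
  exact: (differentiableD (dF1 _) (differentiableD (differentiableD (differentiableB
    (dm 0 2 isT) (dm 1 3 isT)) (dm 2 0 isT)) (dm 3 1 isT)))%N.
- under eq_fun do rewrite qcoordD qcoordM3.
  exact: (differentiableD (dF1 _) (differentiableD (differentiableB (differentiableD
    (dm 0 3 isT) (dm 1 2 isT)) (dm 2 1 isT)) (dm 3 0 isT)))%N.
Qed.

(** Along the line z + t (a + i b) the derivative of F is (a + i b) F'; in the slice of J, sqrt(-1)
    acts as left multiplication by J. *)
Lemma diff_slice p a b : D p.1 -> 0 < p.1.2 -> imaginary_units p.2 ->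
  'd f (slice_point p.1 p.2) (slice_point (a, b) p.2) =
  slice_point (a, b) p.2 * ((dF p.1).1 + p.2 * (dF p.1).2).
Proof.
case: p => z J /= Dz z0 UJ.
pose w t : C := (t * a + z.1, t * b + z.2).
have w0 : w 0 = z by rewrite /w !mul0r !add0r -surjective_pairing.
have dw : is_derive (0 : R) 1 w (a, b).
  by apply: is_derive_pair; apply: is_derive_eq; rewrite /GRing.scale /=; ring.
apply: (diff_along_curve (c := fun t => slice_point (w t) J)
  (phi := fun t => (F (w t)).1 + J * (F (w t)).2)).
- exact: (@differentiable_nonreal (z, J)).
- by rewrite w0.
- apply: quat_is_derive => k k4.
  have -> : (fun s => qcoord (slice_point (w s) J) k) =
     (fun s => s * qcoord (slice_point (a, b) J) k + qcoord (slice_point z J) k).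
    by apply/funext => s; rewrite /slice_point !qcoordD !qcoordZ /=; ring.
  by apply: is_derive_eq; rewrite /GRing.scale /=; ring.
- have cw : {for 0, continuous w}.
    by apply: differentiable_continuous; apply/derivable1_diffP; case: dw.
  have near_D : \forall t \near (0 : R), D (w t).
    by apply: cw; rewrite w0; exact: open_nbhs_nbhs.
  by apply: filterS near_D => t Dt; rewrite fF.
case E : (dF z) => [A B] /=.
have d1 k : is_derive (0 : R) 1 (fun t => qcoord (F (w t)).1 k) (qcoord (a *: A - b *: B) k).
  have [[h _] _] := holF k Dz; rewrite -w0 in h.
  apply: is_derive_eq; first exact: (is_derive_curve h dw).
  by rewrite w0 E /cmul /Ccoord /= !qcoordE; ring.
have d2 k : is_derive (0 : R) 1 (fun t => qcoord (F (w t)).2 k) (qcoord (a *: B + b *: A) k).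
  have [[_ h] _] := holF k Dz; rewrite -w0 in h.
  apply: is_derive_eq; first exact: (is_derive_curve h dw).
  by rewrite w0 E /cmul /Ccoord /= !qcoordE; ring.
have -> : slice_point (a, b) J * (A + J * B) = a *: A - b *: B + J * (a *: B + b *: A).
  have JJ : J * J = -1 by rewrite -expr2.
  rewrite /slice_point /= mulrDl !mulrDr -!scalerAl !mul1r mulrA JJ mulN1r scalerN.
  by rewrite -!scalerAr addrACA -!addrA; congr (_ + _); rewrite addrC addrAC addrC.
exact: is_derive_qaffine.
Qed.

(** The curve is the arc cos t J + sin t K at fixed z: f is affine in the unit, and the arc has
    velocity z.2 K at t = 0. *)
Lemma diff_sphere p K : D p.1 -> 0 < p.1.2 -> imaginary_units p.2 ->
  imaginary_units K -> qdot p.2 K = 0 ->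
  'd f (slice_point p.1 p.2) (p.1.2 *: K) = K * (F p.1).2.
Proof.
case: p => z J /= Dz z0 UJ UK JK.
have rot (x y c : R) : is_derive (0 : R) 1 (fun t => c + (cos t * x + sin t * y)) y.
  apply: is_derive_eq; rewrite /GRing.scale /= cos0 sin0; ring.
apply: (diff_along_curve (c := fun t => slice_point z (cos t *: J + sin t *: K))
  (phi := fun t => (F z).1 + (cos t *: J + sin t *: K) * (F z).2)).
- exact: (@differentiable_nonreal (z, J)).
- by rewrite cos0 sin0 scale1r scale0r addr0.
- apply: quat_is_derive => k k4.
  have -> : (fun s => qcoord (slice_point z (cos s *: J + sin s *: K)) k) =
     (fun s => z.1 * qcoord (1 : H) k +
       (cos s * (z.2 * qcoord J k) + sin s * (z.2 * qcoord K k))).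
    by apply/funext => s; rewrite /slice_point !qcoordD !qcoordZ !qcoordD !qcoordZ; ring.
  by rewrite qcoordZ; exact: rot.
- by apply: filterE => t; rewrite fF //; exact: unit_combination.
move=> k k4.
have -> : (fun t => qcoord ((F z).1 + (cos t *: J + sin t *: K) * (F z).2) k) =
  (fun t => qcoord (F z).1 k + (cos t * qcoord (J * (F z).2) k + sin t * qcoord (K * (F z).2) k)).
  by apply/funext => t; rewrite mulrDl -!scalerAl !qcoordD !qcoordZ.
exact: rot.
Qed.

(** A kernel vector is split as v = q + W with q in R + RJ and W orthogonal to 1 and J, so that q g
    + W s / beta = 0. If q <> 0, pairing with q s and q J s shows g orthogonal to s and J s, against
    the hypothesis on [cform]; then W s = 0 and W = 0. *)
Lemma invertible_nonreal p : D p.1 -> 0 < p.1.2 -> imaginary_units p.2 ->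
  (F p.1).2 != 0 ->
  cform (- (p.2 * (F p.1).2), (F p.1).2) (dF p.1) != 0 ->
  differential_invertible f (slice_point p.1 p.2).
Proof.
move=> Dp p0 Up s0 d0; split; first exact: differentiable_nonreal.
apply: linear_inj_bij => v dv0.
have /imaginary_unitP[J0 J1] := Up.
have diffS a b := diff_slice a b Dp p0 Up.
have diffK K := @diff_sphere p K Dp p0 Up.
case: p Dp p0 Up s0 d0 J0 J1 dv0 diffS diffK => z J /= Dz z0 UJ s0 d0 J0 J1 dv0 diffS diffK.
pose a := qcoord v 0; pose b := qdot v J; pose q := slice_point (a, b) J.
pose W := v - q.
have W0 : qcoord W 0 = 0 by rewrite /W /q /slice_point !qcoordE //= J0 /a; ring.
have JW : qdot J W = 0.
  have -> : qdot J W = qdot v J - a * qcoord J 0 - b * qdot J J.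
    by rewrite /W /q /slice_point /qdot !qcoordE //=; ring.
  by rewrite J0 J1 /b; ring.
set g := (dF z).1 + J * (dF z).2; set s := (F z).2 in s0 d0 diffK *.
have dW : 'd f (slice_point z J) W = z.2^-1 *: (W * s).
  have [->|Wn] := eqVneq W 0; first by rewrite linear0 mul0r scaler0.
  have Wpos : 0 < qdot W W by rewrite lt_def qdot_eq0 Wn qdot_ge0.
  pose n := Num.sqrt (qdot W W).
  have npos : 0 < n by rewrite sqrtr_gt0.
  have n0 : n != 0 by rewrite gt_eqF.
  have UK : imaginary_units (n^-1 *: W).
    apply/imaginary_unitP; split; first by rewrite qcoordZ W0 mulr0.
    by rewrite qdotZ qdotC qdotZ mulrA -expr2 exprVn sqr_sqrtr ?qdot_ge0 // mulVf ?gt_eqF.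
  have lZ c y : 'd f (slice_point z J) (c *: y) = c *: 'd f (slice_point z J) y.
    by rewrite linearZ.
  have := diffK _ UK; rewrite qdotC qdotZ qdotC JW mulr0 => /(_ erefl) dK.
  have -> : 'd f (slice_point z J) W =
      (n / z.2) *: 'd f (slice_point z J) (z.2 *: (n^-1 *: W)).
    by rewrite -lZ !scalerA divfK ?gt_eqF // divff // scale1r.
  rewrite dK -scalerAl !scalerA; congr (_ *: _).
  by rewrite mulrAC divff // mul1r.
have E : q * g + z.2^-1 *: (W * s) = 0.
  rewrite -dW -[q * g]diffS -/q -linearD /W addrC subrK //.
have qq : qdot q q = a ^+ 2 + b ^+ 2.
  have -> : qdot q q = a ^+ 2 + 2 * a * b * qcoord J 0 + b ^+ 2 * qdot J J.
    by rewrite /q /slice_point /qdot !qcoordE //=; ring.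
  by rewrite J0 J1; ring.
(* Multiplication scales scalar products: <q g, q c s> = |q|^2 <g, c s>, while <W s, q c s> = <W, q
   c> |s|^2 vanishes. It is used for c = 1 and c = J, when q c stays in R + RJ. *)
have perp c : qdot W (q * c) = 0 -> qdot q q * qdot g (c * s) = 0.
  move=> Wc; rewrite -qdot_mull.
  have := congr1 (fun x => qdot x (q * (c * s))) E.
  by rewrite qdotD qdotZ mulrA qdot_mulr Wc mul0r mulr0 addr0 qdot0.
have p1 : qdot q q * qdot g s = 0.
  rewrite -[s]mul1r; apply: perp; rewrite mulr1 qdotC.
  have -> : qdot q W = a * qcoord W 0 + b * qdot J W.
    by rewrite /q /slice_point /qdot !qcoordE //=; ring.
  by rewrite W0 JW; ring.
have p2 : qdot q q * qdot g (J * s) = 0.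
  apply: perp; rewrite qdotC.
  have -> : qdot (q * J) W = a * qdot J W + b * qdot (J * J) W.
    by rewrite /q /slice_point mulrDl -!scalerAl mul1r qdotD !qdotZ.
  have -> : J * J = -1 by rewrite -expr2.
  rewrite JW; have -> : qdot (-1) W = - qcoord W 0 by rewrite /qdot !qcoordE //=; ring.
  by rewrite W0; ring.
have q0 : q = 0.
  apply/eqP; rewrite -qdot_eq0; apply/negPn/negP => qn.
  move/negP: d0; apply; apply/eqP; rewrite cformE.
  move/eqP: p1; move/eqP: p2; rewrite !mulf_eq0 (negbTE qn) /= => /eqP g2 /eqP g1.
  apply/pair_equal_spec; split => /=.
    have -> : qdot (- (J * s)) (dF z).1 - qdot s (dF z).2 = - qdot g (J * s).
      have -> : qdot g (J * s) = qdot (J * s) (dF z).1 + qdot J J * qdot s (dF z).2.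
        by rewrite -qdot_mull /g qdotD (qdotC (dF z).1) (qdotC (J * (dF z).2)).
      by rewrite J1 mul1r -scaleN1r qdotZ; ring.
    by rewrite g2 oppr0.
  rewrite -g1 /g qdotD (qdotC _ (dF z).2) /qdot !qcoordE J0; ring.
move: E; rewrite q0 mul0r add0r => /eqP; rewrite scaler_eq0 invr_eq0 gt_eqF //= => /eqP Ws.
by have := qmul_eq0 Ws s0; rewrite /W q0 subr0.
Qed.

(** * Invertibility of the differential at real points *)

Lemma qcoord_unit_le J k : imaginary_units J -> (k < 4)%N -> `|qcoord J k| <= 1.
Proof.
move=> /imaginary_unitP[J0]; rewrite /qdot J0 mulr0 add0r -!expr2 => J1 k4.
rewrite -(@expr_le1 _ 2) // real_normK ?num_real //.
have s1 := sqr_ge0 (qcoord J 1); have s2 := sqr_ge0 (qcoord J 2).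
have s3 := sqr_ge0 (qcoord J 3).
by case: k k4 => [|[|[|[|//]]]] _; rewrite ?J0; lra.
Qed.

Lemma qcoord_mul_unit_le J (q : H) (M : R) k : imaginary_units J ->
  (forall k, (k < 4)%N -> `|qcoord q k| <= M) -> (k < 4)%N ->
  `|qcoord (J * q) k| <= 4 * M.
Proof.
move=> UJ qM.
have c i j : (i < 4)%N -> (j < 4)%N -> - M <= qcoord J i * qcoord q j <= M.
  move=> i4 j4; rewrite -ler_norml normrM -[leRHS]mul1r.
  by apply: ler_pM => //; [exact: qcoord_unit_le|exact: qM].
case: k => [|[|[|[|//]]]] _; rewrite ler_norml.
- rewrite qcoordM0; have := c 0%N 0%N isT isT; have := c 1%N 1%N isT isT.
  have := c 2%N 2%N isT isT; have := c 3%N 3%N isT isT.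
  move: (_ * _) (_ * _) (_ * _) (_ * _) => x1 x2 x3 x4; lra.
- rewrite qcoordM1; have := c 0%N 1%N isT isT; have := c 1%N 0%N isT isT.
  have := c 2%N 3%N isT isT; have := c 3%N 2%N isT isT.
  move: (_ * _) (_ * _) (_ * _) (_ * _) => x1 x2 x3 x4; lra.
- rewrite qcoordM2; have := c 0%N 2%N isT isT; have := c 1%N 3%N isT isT.
  have := c 2%N 0%N isT isT; have := c 3%N 1%N isT isT.
  move: (_ * _) (_ * _) (_ * _) (_ * _) => x1 x2 x3 x4; lra.
- rewrite qcoordM3; have := c 0%N 3%N isT isT; have := c 1%N 2%N isT isT.
  have := c 2%N 1%N isT isT; have := c 3%N 0%N isT isT.
  move: (_ * _) (_ * _) (_ * _) (_ * _) => x1 x2 x3 x4; lra.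
Qed.

Lemma continuous_halfplane (x : H) : {for x, continuous halfplane}.
Proof.
have c k : qcoord y k @[y --> x] --> qcoord x k by exact: continuous_qcoord.
apply: (@cvgC R H (nbhs x) (nbhs_filter x) halfplane (halfplane x)).2; split => /=.
  exact: c.
have cs : qcoord y 1 * qcoord y 1 + qcoord y 2 * qcoord y 2 +
    qcoord y 3 * qcoord y 3 @[y --> x] --> qcoord x 1 * qcoord x 1 + qcoord x 2 * qcoord x 2 +
    qcoord x 3 * qcoord x 3.
  exact: (cvgD (cvgD (cvgM (c 1%N) (c 1%N)) (cvgM (c 2%N) (c 2%N))) (cvgM (c 3%N) (c 3%N))).
exact: (cvg_comp _ _ cs (@sqrt_continuous R _)).
Qed.

(** With maximum norms, the imaginary part satisfies |Im x|^2 <= 3 |x|^2 <= (2 |x|)^2. *)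
Lemma norm_halfplane_le (x : H) : `|halfplane x| <= 2 * `|x|.
Proof.
have -> : `|halfplane x| = Num.max `|qcoord x 0| `|imnorm x| by [].
rewrite ge_max; apply/andP; split.
  by apply: le_trans (qcoord_le_norm x 0) _; have := normr_ge0 x; lra.
rewrite ger0_norm ?sqrtr_ge0 // -(@ler_pXn2r _ 2) ?nnegrE ?sqrtr_ge0 ?mulr_ge0 //.
rewrite imnorm_sqr /qdot !qcoordE //=.
have c k : qcoord x k * qcoord x k <= `|x| ^+ 2.
  by rewrite -expr2 -real_normK ?num_real // ler_pXn2r ?nnegrE // qcoord_le_norm.
have := c 1%N; have := c 2%N; have := c 3%N; have := sqr_ge0 `|x|.
by rewrite exprMn; lra.
Qed.

(** The unit in the polar form has no limit at a real point, so the error is estimated directly.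
    Nothing is asked of the unit J attached to an increment h beyond the bound on multiplication by
    it. *)
Lemma is_diff_real z : D z -> z.2 = 0 -> (F z).2 = 0 -> (dF z).2 = 0 ->
  is_diff (z.1%:A : H) f (fun v => v * (dF z).1).
Proof.
move=> Dz z0 F20 dF20; set A := (dF z).1.
apply: near_is_diff.
- by move=> a u v; rewrite mulrDl scalerAl.
- move=> v; apply: (@differentiable_continuous _ _ _ v).
  have dm i j : differentiable (fun v : H => qcoord v i * qcoord A j) v.
    exact: (differentiableM (differentiable_qcoord i v) (differentiable_cst (qcoord A j) v)).
  apply: quat_differentiable => -[|[|[|[|//]]]] _.
  + under eq_fun do rewrite qcoordM0.
    exact: (differentiableB (differentiableB (differentiableB
      (dm 0 0) (dm 1 1)) (dm 2 2)) (dm 3 3))%N.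
  + under eq_fun do rewrite qcoordM1.
    exact: (differentiableB (differentiableD (differentiableD
      (dm 0 1) (dm 1 0)) (dm 2 3)) (dm 3 2))%N.
  + under eq_fun do rewrite qcoordM2.
    exact: (differentiableD (differentiableD (differentiableB
      (dm 0 2) (dm 1 3)) (dm 2 0)) (dm 3 1))%N.
  + under eq_fun do rewrite qcoordM3.
    exact: (differentiableD (differentiableB (differentiableD
      (dm 0 3) (dm 1 2)) (dm 2 1)) (dm 3 0))%N.
(* The F_1 part of the error costs one share and the F_2 part four, by [qcoord_mul_unit_le];
   [|w| <= 2 * |h|] doubles the total of five. *)
move=> e e0; have e1 : 0 < e / 10 by rewrite divr_gt0.
have h0 : halfplane 0 = 0.
  by rewrite /halfplane /imnorm !qcoord0 mulr0 !addr0 sqrtr0.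
have ch : (halfplane h @[h --> (0 : H)] --> (0 : C)).
  by rewrite -[X in _ --> X]h0; exact: continuous_halfplane.
pose close (w : C) := forall k : 'I_4,
    `|qcoord (F (w + z)).1 k - qcoord (F z).1 k - (cmul (Ccoord (dF z) k) w).1|
      <= e / 10 * `|w| /\
    `|qcoord (F (w + z)).2 k - qcoord (F z).2 k - (cmul (Ccoord (dF z) k) w).2|
      <= e / 10 * `|w|.
have near1 : \forall w \near (0 : C), close w.
  apply: (@filter_forall C 'I_4 _ (nbhs (0 : C)) (nbhs_filter (0 : C))) => k.
  have [[h1 h2] _] := holF k Dz.
  exact: filterI (is_diff_near h1 e1) (is_diff_near h2 e1).
have near2 : \forall w \near (0 : C), D (w + z).
  have cz : (fun w : C => w + z) @ (0 : C) --> z.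
    by rewrite -[X in _ --> X]add0r; apply: cvgD; [exact: cvg_id|exact: cvg_cst].
  by apply: cz; exact: open_nbhs_nbhs.
have near3 : \forall h \near (0 : H), close (halfplane h) by exact: ch _ near1.
have near4 : \forall h \near (0 : H), D (halfplane h + z) by exact: ch _ near2.
apply: filterS2 near3 near4 => h Hk Dh.
have [J UJ hE] := polar_form_ex h.
have Eh : h + z.1%:A = slice_point (halfplane h + z) J.
  rewrite {1}hE /slice_point /= z0 addr0 scalerDl -!addrA; congr (_ + _).
  by rewrite addrC.
have Ez : z.1%:A = slice_point z J by rewrite /slice_point z0 scale0r addr0.
rewrite Eh [in f (_%:A)]Ez !fF // F20 mulr0 addr0.
set w := halfplane h in Hk hE Dh Eh *.
(* As h = w.1 + J w.2, the linear term h A splits, and F_1 and F_2 are each compared with their own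
   first-order part. *)
have -> : (F (w + z)).1 + J * (F (w + z)).2 - (F z).1 - h * A =
    ((F (w + z)).1 - (F z).1 - w.1 *: A) + J * ((F (w + z)).2 - w.2 *: A).
  rewrite hE /slice_point mulrDl -!scalerAl mul1r mulrBr -scalerAr opprD.
  move: (w.1 *: A) (w.2 *: (J * A)) (F _).1 (F z).1 (J * _) => a b c d g.
  by apply: quatP => k _; rewrite !(qcoordD, qcoordN); ring.
have b1 k : (k < 4)%N -> `|qcoord ((F (w + z)).1 - (F z).1 - w.1 *: A) k| <= e / 10 * `|w|.
  move=> k4; have [+ _] := Hk (Ordinal k4).
  by rewrite /cmul /Ccoord dF20 qcoord0 mul0r subr0 /= -/A !qcoordE mulrC.
have b2 k : (k < 4)%N -> `|qcoord ((F (w + z)).2 - w.2 *: A) k| <= e / 10 * `|w|.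
  move=> k4; have [_ +] := Hk (Ordinal k4).
  by rewrite /cmul /Ccoord /= dF20 F20 qcoord0 mul0r addr0 subr0 -/A !qcoordE mulrC.
apply: norm_le_qcoord => [|k k4]; first by rewrite mulr_ge0 // ltW.
rewrite qcoordD; apply: le_trans (ler_normD _ _) _.
have := b1 k k4; have := qcoord_mul_unit_le UJ b2 k4.
have : e / 10 * `|w| <= e / 10 * (2 * `|h|) by apply: ler_wpM2l; [exact: ltW|exact: norm_halfplane_le].
move: (`|w|) (`|h|) (`|qcoord _ _|) (`|qcoord _ _|) => W h1 c1 c2; lra.
Qed.

Lemma invertible_real z : D z -> z.2 = 0 -> (F z).2 = 0 -> (dF z).2 = 0 ->
  (dF z).1 != 0 -> differential_invertible f (z.1%:A).
Proof.
move=> Dz z0 F20 dF20 A0; have [df dE] := is_diff_real Dz z0 F20 dF20.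
by split=> //; apply: linear_inj_bij => v; rewrite dE => /qmul_eq0; apply.
Qed.

End Injective.

Theorem theorem34 (R : realType) (D : set (R * R)) (f : quat R -> quat R)
  (D_open : open D) (D_sym : symmetric_wrt_real_axis D)
  (f_reg : slice_regular D f)
  (f_inj : {in circularization D &, injective f}) :
  singular_set D f = set0 /\
  (forall x, circularization D x -> differential_invertible f x).
Proof.
suff inv x : circularization D x -> differential_invertible f x.
  by split=> //; apply/seteqP; split=> // x [/inv].
case: f_reg => F [stemF fF C1 db].
move: (hol_stem D_open C1 db); move: (d_alpha F) => dF holF.
have nonreal p : D p.1 -> 0 < p.1.2 -> imaginary_units p.2 ->
    differential_invertible f (slice_point p.1 p.2).
  move=> Dp p0 Up.
  apply: (invertible_nonreal D_open fF holF Dp p0 Up).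
    by apply: (F2_neq0 fF f_inj Dp); rewrite gt_eqF.
  have := dnorm_form_neq0 D_open fF holF f_inj Dp p0 Up.
  by apply: contra => /eqP e; rewrite /dnorm_form vec_self e addr0.
move=> [z [J [Dz UJ ->]]]; have [z0|z0|z0] := ltgtP z.2 0.
(* A point below the real axis is rewritten as alpha + (-J)(-beta); symmetry of [D] puts the
   conjugate in the domain. *)
- have -> : slice_point z J = slice_point (conjC z) (- J).
    by rewrite /slice_point /= scaleNr scalerN opprK.
  apply: (nonreal (conjC z, - J)); [exact: D_sym|by rewrite /= oppr_gt0|].
  by rewrite /imaginary_units /= sqrrN.
- exact: (nonreal (z, J)).
rewrite /slice_point z0 scale0r addr0.
apply: (invertible_real D_open fF holF Dz z0).
- exact: (F2_real stemF Dz z0).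
- exact: (dF2_real D_open stemF holF Dz z0).
- exact: (dF1_real_neq0 D_open stemF fF holF f_inj Dz z0).
Qed.
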